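(* Given an instance of the LSPC problem, an optimum (minimum-cost) SLRA solution can be found in time polynomial in the number of resources, the number of timeslots $T$, and $H=\max_{t\in[1,T]} d_t$.
   Context: LSPC problem. The input is a range of timeslots $[1,T]$ with an integral demand $d_t\ge 0$ at each timeslot $t$, a set of resources, and an integer $k$. Each resource $i$ has an interval $[s(i),e(i)]\subseteq[1,T]$, an integer capacity $w(i)$ and a cost $c(i)$; resources are short (interval is a single timeslot) or long (interval may span one or more timeslots). A resource is active at $t$ if $t$ lies in its interval. The cost of a multiset of resources is the sum of costs with multiplicity. A profile over a range $[a,b]$ is a function $Q$ assigning an integer $Q(t)$ to each $t\in[a,b]$, required to satisfy $Q(t)\le d_t$; its measure is $\sum_{t\in[a,b]}Q(t)$. A multiset $S$ of resources is good if for each timeslot $t$ it contains at most one (copy of one) short resource active at $t$. For good $S$ and timeslot $t$, $Q^{\mathrm{sh}}_S(t)$ denotes the capacity of the unique short resource of $S$ active at $t$ if one exists, and $0$ otherwise; for a long resource $i$, $f_S(i)$ denotes the number of copies of $i$ in $S$. A good multiset $S$ is an SLRA cover for a profile $Q$ over $[a,b]$ if for every $t\in[a,b]$ there is a long resource $i\in S$ active at $t$ with $w(i)f_S(i)\ge Q(t)-Q^{\mathrm{sh}}_S(t)$ (when $Q(t)-Q^{\mathrm{sh}}_S(t)>0$). A good multiset $S$ is an SLRA solution if there exists a profile $Q$ over $[1,T]$ of measure $k$ such that $S$ is an SLRA cover for $Q$. An optimum SLRA solution is an SLRA solution of minimum cost.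
   Formalization: Resource costs are assumed nonnegative (with a negative-cost long resource the minimum over multisets need not exist), and when no SLRA solution exists the algorithm reports this instead of returning an optimum. *)

(* Defs.v *)
From HB Require Import structures.
From mathcomp Require Import all_boot all_order all_algebra.
Set Implicit Arguments.
Unset Strict Implicit.
Unset Printing Implicit Defensive.
Import Order.TTheory GRing.Theory Num.Theory.
Local Open Scope ring_scope.

(** * LSPC instances and SLRA solutions *)

(** Timeslots are the naturals [1 .. horizon]; the values of [demand] outside
    that range are never used. Costs are nonnegative numbers: with a long
    resource of negative cost a minimum-cost solution need not exist. *)
Record lspc (R : realDomainType) := LSPC {
  horizon : nat;
  demand : nat -> nat;
  target : int;
  nres : nat;
  is_long : 'I_nres -> bool;
  start : 'I_nres -> nat;
  finish : 'I_nres -> nat;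
  capacity : 'I_nres -> int;
  cost : 'I_nres -> R;
  intervalP : forall i, (0 < start i <= finish i)%N && (finish i <= horizon)%N;
  shortP : forall i, ~~ is_long i -> start i = finish i;
  cost_ge0 : forall i, 0 <= cost i
}.

Section SLRA.
Variables (R : realDomainType) (I : lspc R).
Implicit Types (S : {ffun 'I_(nres I) -> nat}) (Q : nat -> int).

Definition max_demand : nat := \max_(1 <= t < (horizon I).+1) demand I t.

Definition active (i : 'I_(nres I)) (t : nat) : bool :=
  (start i <= t <= finish i)%N.

(** A multiset of resources is given by its multiplicity function, so that
    [S i] is the number of copies of [i] in [S]. *)
Definition multiset_cost S : R := \sum_i cost i *+ S i.

Definition good S : Prop :=
  forall t, (0 < t <= horizon I)%N ->
    (\sum_(i | ~~ is_long i && active i t) S i <= 1)%N.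

(** For good [S] there is at most one [i] to pick. *)
Definition short_profile S (t : nat) : int :=
  if [pick i | [&& ~~ is_long i, active i t & (0 < S i)%N]] is Some i
  then capacity i else 0.

Definition profile (a b : nat) Q : Prop :=
  forall t, (a <= t <= b)%N -> Q t <= (demand I t)%:Z.

Definition measure (a b : nat) Q : int := \sum_(a <= t < b.+1) Q t.

Definition slra_cover S (a b : nat) Q : Prop :=
  good S /\
  forall t, (a <= t <= b)%N -> 0 < Q t - short_profile S t ->
    exists i, [/\ is_long i, (0 < S i)%N, active i t
                & Q t - short_profile S t <= capacity i * (S i)%:Z].

Definition slra_solution S : Prop :=
  exists Q, [/\ profile 1 (horizon I) Q, measure 1 (horizon I) Q = target I
              & slra_cover S 1 (horizon I) Q].

Definition slra_optimum S : Prop :=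
  slra_solution S /\
  forall S', slra_solution S' -> multiset_cost S <= multiset_cost S'.

End SLRA.

Arguments active {R} I i t.
Arguments multiset_cost {R} I S.
Arguments good {R} I S.
Arguments short_profile {R} I S t.
Arguments slra_cover {R} I S a b Q.
Arguments slra_solution {R} I S.
Arguments slra_optimum {R} I S.

(** * Model of computation

    A random access machine with structured control. Memory consists of
    arrays, named by naturals and indexed by integers: integer arrays, and
    cost arrays whose entries are numbers of the type [R] of the costs, which
    can only be copied, added, subtracted and compared. Every executed
    assignment or test takes one step (an expression of a fixed program has a
    fixed size). There is no multiplication: with it, unit-cost steps would
    build numbers of exponential bit length and would not measure polynomial
    time. *)

Inductive iexp : Type :=
  | IConst of int
  | IGet of nat & iexp
  | IAdd of iexp & iexp
  | ISub of iexp & iexp.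

Inductive cexp : Type :=
  | CZero
  | CGet of nat & iexp
  | CAdd of cexp & cexp
  | CSub of cexp & cexp.

Inductive bexp : Type :=
  | ILe of iexp & iexp
  | CLe of cexp & cexp
  | BNot of bexp
  | BAnd of bexp & bexp.

Inductive cmd : Type :=
  | Skip
  | ISet of nat & iexp & iexp   (* integer array, index, new value *)
  | CSet of nat & iexp & cexp   (* cost array, index, new value *)
  | Seq of cmd & cmd
  | If of bexp & cmd & cmd
  | While of bexp & cmd.

Record state (R : realDomainType) := State {
  imem : nat -> int -> int;
  cmem : nat -> int -> R
}.

Definition upd (A : Type) (m : nat -> int -> A) (a : nat) (z : int) (v : A) :
    nat -> int -> A :=
  fun a' z' => if (a' == a) && (z' == z) then v else m a' z'.

Section Semantics.
Variable R : realDomainType.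
Implicit Type st : state R.

Fixpoint ieval st (e : iexp) : int :=
  match e with
  | IConst z => z
  | IGet a e1 => imem st a (ieval st e1)
  | IAdd e1 e2 => ieval st e1 + ieval st e2
  | ISub e1 e2 => ieval st e1 - ieval st e2
  end.

Fixpoint ceval st (e : cexp) : R :=
  match e with
  | CZero => 0
  | CGet a e1 => cmem st a (ieval st e1)
  | CAdd e1 e2 => ceval st e1 + ceval st e2
  | CSub e1 e2 => ceval st e1 - ceval st e2
  end.

Fixpoint beval st (b : bexp) : bool :=
  match b with
  | ILe e1 e2 => ieval st e1 <= ieval st e2
  | CLe e1 e2 => ceval st e1 <= ceval st e2
  | BNot b1 => ~~ beval st b1
  | BAnd b1 b2 => beval st b1 && beval st b2
  end.

(** [exec p st n st']: run from [st], the program [p] halts in [st'] after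
    [n] steps. *)
Inductive exec : cmd -> state R -> nat -> state R -> Prop :=
  | ExecSkip st : exec Skip st 1 st
  | ExecISet st a e v :
      exec (ISet a e v) st 1
        (State (upd (imem st) a (ieval st e) (ieval st v)) (cmem st))
  | ExecCSet st a e v :
      exec (CSet a e v) st 1
        (State (imem st) (upd (cmem st) a (ieval st e) (ceval st v)))
  | ExecSeq p1 p2 st1 st2 st3 n1 n2 :
      exec p1 st1 n1 st2 -> exec p2 st2 n2 st3 ->
      exec (Seq p1 p2) st1 (n1 + n2) st3
  | ExecIfTrue b p1 p2 st st' n :
      beval st b -> exec p1 st n st' -> exec (If b p1 p2) st n.+1 st'
  | ExecIfFalse b p1 p2 st st' n :
      ~~ beval st b -> exec p2 st n st' -> exec (If b p1 p2) st n.+1 st'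
  | ExecWhileFalse b p st :
      ~~ beval st b -> exec (While b p) st 1 st
  | ExecWhileTrue b p st1 st2 st3 n1 n2 :
      beval st1 b -> exec p st1 n1 st2 -> exec (While b p) st2 n2 st3 ->
      exec (While b p) st1 (n1 + n2).+1 st3.

End Semantics.

(** * Input and output conventions *)

Definition table (A : Type) (x0 : A) (n : nat) (f : 'I_n -> A) (z : int) : A :=
  if z is Posz m then oapp f x0 (insub m) else x0.

(** Integer array 0 holds the horizon, the number of resources and the target
    in cells 0, 1 and 2; array 1 holds the demands in cells [1 .. horizon];
    arrays 2 to 5 hold, in cells [0 .. nres - 1], the starts, finishes,
    capacities and kinds (1 for long, 0 for short) of the resources, and cost
    array 0 holds their costs. All other cells are 0. *)
Definition input (R : realDomainType) (I : lspc R) : state R :=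
  State
    (fun a => match a with
      | 0 => fun z => nth 0 [:: (horizon I)%:Z; (nres I)%:Z; target I]
                        (if z is Posz m then m else 3)
      | 1 => fun z => if z is Posz t then
                        if (0 < t <= horizon I)%N then (demand I t)%:Z else 0
                      else 0
      | 2 => table 0 (fun i => (start (l := I) i)%:Z)
      | 3 => table 0 (fun i => (finish (l := I) i)%:Z)
      | 4 => table 0 (capacity (l := I))
      | 5 => table 0 (fun i => (is_long (l := I) i : nat)%:Z)
      | _ => fun=> 0
      end)
    (fun a => match a with
      | 0 => table 0 (cost (l := I))
      | _ => fun=> 0
      end).

(** Cell 0 of integer array 6 tells whether a multiset is returned; if so,
    cells [0 .. n - 1] of array 7 are its multiplicities. *)
Definition returns (R : realDomainType) (n : nat) (st : state R)
    (S : {ffun 'I_n -> nat}) : Prop :=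
  imem st 6 0 = 1 /\ forall i : 'I_n, imem st 7 (i : nat)%:Z = (S i)%:Z.

Definition returns_none (R : realDomainType) (st : state R) : Prop :=
  imem st 6 0 = 0.

(* Main.v *)
Require Import Defs.
From HB Require Import structures.
From mathcomp Require Import all_boot all_order all_algebra.
From mathcomp Require Import zify.
Import Order.TTheory GRing.Theory Num.Theory.
Local Open Scope ring_scope.

(** Only the pointwise maximum of [capacity i * S i] over the active long
    resources matters, so sub-instances are indexed by a range of slots [[a,b)],
    a base height [h] available for free on the whole range, and an amount [q]
    to be covered. In a solution whose tallest long resource [j] at slot [b - 1]
    exceeds [h], let [x] be the first slot of the range at which [j] is active
    and tallest. Resources other than [j] starting before [x] are useless from
    [x] on once [j] supplies the base height there, and [j] is never needed
    before [x]; hence the solution splits, at no extra cost, into one for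
    [[a,x)] with base [h], the copies of [j], and one for [[x,b)] with base the
    height of [j]. If no long resource exceeds [h] at [b - 1], that slot is
    covered by the base and at most one short resource. All coordinates are
    bounded by the sum of the demands plus [nres + horizon], so relaxing all
    rules Bellman-Ford style for enough rounds takes polynomial time; each table
    entry carries its cost and its whole vector of multiplicities. *)

Set Implicit Arguments.
Unset Strict Implicit.
Unset Printing Implicit Defensive.

(** The rules form a relation shared by both halves of the proof: it is sound, and every valid
    multiset without short resources of negative capacity costs at least as much as some derivation
    of bounded depth. The program only has to follow this relation. Three obstacles shape it.
    Capacities and multiplicities may exceed any polynomial bound, while table indices stay below
    [B]; since every demand is below [B], heights and numbers of copies are truncated at [B - 1],
    which is harmless once short capacities are nonnegative. Short resources of negative capacity
    are therefore deleted beforehand. Profiles may take negative values, so it is enough to cover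
    the nonnegative part of the target: any surplus is removed at slot 1, which must exist. Finally,
    the machine cannot multiply, yet long resources are compared by capacity times copies: this
    product is accumulated by addition along with the copies, and addresses use tables of multiples
    of powers of [B]. *)

(** For [0 < a], the point [(a, b, h, q)] stands for covering an amount [q] on
    the slots [a, ..., b - 1] with base height [h]. Slots are numbered from 1, so
    that [(0, 0, i, f)] is free to stand for [f] copies of resource [i]. *)
Definition point : Type := (nat * nat * nat * nat)%type.

Lemma leq_addP q u v : (q <= u + v)%N ->
  exists q1 q2, [/\ q = (q1 + q2)%N, (q1 <= u)%N & (q2 <= v)%N].
Proof. by move=> h; exists (minn q u), (q - minn q u)%N; split; lia. Qed.

(** * Subproblems on ranges of slots *)

Section Subproblems.
Variables (R : realDomainType) (I : lspc R).
Notation n := (nres I).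
Implicit Types (S : {ffun 'I_n -> nat}) (t : nat).

(** Zero outside the horizon, in agreement with the contents of integer array 1. *)
Definition dem t : nat := if (0 < t <= horizon I)%N then demand I t else 0.

Definition dsum : nat := \sum_(1 <= t < (horizon I).+1) demand I t.

Definition nshort S t : nat := \sum_(i | ~~ is_long i && active I i t) S i.

(** A sum rather than a choice, so that it is additive in [S]; [short_profileE] relates it to
    [short_profile]. *)
Definition short_cap S t : int :=
  \sum_(i | ~~ is_long i && active I i t) capacity i * (S i)%:Z.

Definition total_cap S : int := \sum_i capacity i * (S i)%:Z.

(** The base acts as one more active long resource, of height [h]. For [h = 0] this is the condition
    of a cover, a resource absent from [S] having height 0. *)
Definition reach (h : nat) S t (v : nat) : Prop :=
  (v <= dem t)%N /\
  (v%:Z <= short_cap S t + h%:Z \/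
   exists i, [/\ is_long i, active I i t
               & v%:Z <= short_cap S t + capacity i * (S i)%:Z]).

(** Short resources are confined to the range, long ones are not; hence solutions on consecutive
    ranges never use the same short resource, and their sum stays good. Only a lower bound on the
    amount is asked, the surplus being removed in [valid_solution]. *)
Definition valid (p : point) S : Prop :=
  let: (a, b, h, q) := p in
  if a == 0 then forall j : 'I_n, S j = ((j == h :> nat) * q)%N else
  [/\ forall t, (nshort S t <= 1)%N,
      forall i, ~~ is_long i -> (0 < S i)%N -> (a <= start i < b)%N
    & exists Q : nat -> nat, (forall t, (a <= t < b)%N -> reach h S t (Q t)) /\
        (q <= \sum_(a <= t < b) Q t)%N].

Definition origin : point := (0, 0, 0, 0).

Definition madd3 S1 S2 S3 : {ffun 'I_n -> nat} :=
  [ffun i => (S1 i + S2 i + S3 i)%N].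

Lemma cost_madd3 S1 S2 S3 :
  multiset_cost I (madd3 S1 S2 S3) =
  multiset_cost I S1 + multiset_cost I S2 + multiset_cost I S3.
Proof.
rewrite /multiset_cost -!big_split; apply: eq_bigr => i _ /=.
by rewrite ffunE !mulrnDr.
Qed.

Lemma total_cap_madd3 S1 S2 S3 :
  total_cap (madd3 S1 S2 S3) = total_cap S1 + total_cap S2 + total_cap S3.
Proof.
rewrite /total_cap -!big_split; apply: eq_bigr => i _ /=.
by rewrite ffunE !PoszD !mulrDr.
Qed.

Lemma short_cap_madd3 S1 S2 S3 t :
  short_cap (madd3 S1 S2 S3) t = short_cap S1 t + short_cap S2 t + short_cap S3 t.
Proof.
rewrite /short_cap -!big_split; apply: eq_bigr => i _ /=.
by rewrite ffunE !PoszD !mulrDr.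
Qed.

Lemma nshort_madd3 S1 S2 S3 t :
  nshort (madd3 S1 S2 S3) t = (nshort S1 t + nshort S2 t + nshort S3 t)%N.
Proof. by rewrite /nshort -!big_split; apply: eq_bigr => i _ /=; rewrite ffunE. Qed.

Lemma active_short i t : ~~ is_long i -> active I i t -> t = start i.
Proof. by move=> /shortP; rewrite /active; lia. Qed.

Lemma nshort_eq0 S t :
  (forall i, ~~ is_long i -> active I i t -> S i = 0%N) -> nshort S t = 0%N.
Proof. by move=> h; apply: big1 => i /andP[li ai]; apply: h. Qed.

Lemma short_cap_eq0 S t :
  (forall i, ~~ is_long i -> active I i t -> S i = 0%N) -> short_cap S t = 0.
Proof. by move=> h; apply: big1 => i /andP[li ai]; rewrite h // mulr0. Qed.

Lemma valid_origin S : valid origin S -> forall j, S j = 0%N.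
Proof. by move=> /= h j; rewrite h muln0. Qed.

(** Added copies are safe when the capacity is nonnegative. For a negative one the hypothesis
    already gives [v <= s], and the base suffices, being a natural number. *)
Lemma grow_copies (c s v : int) (m m' h : nat) : v <= s + c * m%:Z -> (m <= m')%N ->
  v <= s + c * m'%:Z \/ v <= s + h%:Z.
Proof.
move=> vm mm; have [c0|c0] := lerP 0 c; [left|right]; apply: le_trans vm _.
  by rewrite lerD2l ler_wpM2l // lez_nat.
by rewrite lerD2l (@le_trans _ _ 0) // mulr_le0_ge0 // ltW.
Qed.

(** * Decomposition rules: soundness and completeness *)

Section Rules.
Variable B : nat.

(** A solution of the first point is the sum of solutions of the other three. All
    cases share their parameters, since the program enumerates all of them in
    one nest of loops. *)
Inductive rule (a b h x g q1 q2 i f : nat) : point -> point -> point -> point -> Prop :=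
| rule_copy : (f.+1 < B)%N ->
    rule a b h x g q1 q2 i f (0, 0, i, f.+1) (0, 0, i, f) (0, 0, i, 1) origin
| rule_empty : (0 < a)%N ->
    rule a b h x g q1 q2 i f (a, a, h, 0) origin origin origin
| rule_none : (0 < a <= x)%N -> b = x.+1 -> (q1 + q2 < B)%N ->
    (q2 <= dem x)%N -> (q2 <= h)%N ->
    rule a b h x g q1 q2 i f (a, b, h, q1 + q2)%N (a, x, h, q1) origin origin
| rule_short (j : 'I_n) : i = j -> ~~ is_long j -> start j = x ->
    (0 < a <= x)%N -> b = x.+1 -> (q1 + q2 < B)%N ->
    (q2 <= dem x)%N -> q2%:Z <= h%:Z + capacity j ->
    rule a b h x g q1 q2 i f (a, b, h, q1 + q2)%N (a, x, h, q1) (0, 0, i, 1) origin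
| rule_long (j : 'I_n) : i = j -> is_long j ->
    (0 < a <= x)%N -> (x <= b)%N -> (start j <= x)%N -> (b <= (finish j).+1)%N ->
    g%:Z <= capacity j * f%:Z -> (q1 + q2 < B)%N ->
    rule a b h x g q1 q2 i f (a, b, h, q1 + q2)%N (a, x, h, q1) (0, 0, i, f) (x, b, g, q2).

(** Depth counts rounds of relaxation: the base cases, available at depth 0, are the entries written
    by [init], and the bound [B] on the parameters is the extent of the loop nest. *)
Inductive derivable : nat -> point -> R -> Prop :=
| derivable_origin r : derivable r origin 0
| derivable_unit r (j : 'I_n) : derivable r (0, 0, j : nat, 1) (cost j)
| derivable_step r a b h x g q1 q2 i f d s1 s2 s3 c1 c2 c3 :
    all (fun k => k < B)%N [:: a; b; h; x; g; q1; q2; i; f] ->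
    rule a b h x g q1 q2 i f d s1 s2 s3 ->
    derivable r s1 c1 -> derivable r s2 c2 -> derivable r s3 c3 ->
    derivable r.+1 d (c1 + c2 + c3).

(** Common core of [rule_none] and [rule_short]: slot [x] is served by the base and the short
    resource of [S2], if any, while the short resources of [S1] all start before [x]. *)
Lemma valid_slot a x h q1 q2 S1 S2 S3 :
  (0 < a <= x)%N -> valid (a, x, h, q1) S1 ->
  (forall j, S3 j = 0%N) ->
  (forall i, ~~ is_long i -> (0 < S2 i)%N -> start i = x) ->
  (nshort S2 x <= 1)%N ->
  (q2 <= dem x)%N -> q2%:Z <= h%:Z + short_cap S2 x ->
  valid (a, x.+1, h, q1 + q2)%N (madd3 S1 S2 S3).
Proof.
move=> /andP[a0 ax] /=; rewrite eqn0Ngt a0 /= => -[c1 r1 [Q [hQ qQ]]] S30 r2 c2 q2d q2h.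
have n3 t : nshort S3 t = 0%N by apply: nshort_eq0.
have k3 t : short_cap S3 t = 0 by apply: short_cap_eq0.
have S10 i t : ~~ is_long i -> active I i t -> (x <= t)%N -> S1 i = 0%N.
  move=> li ai xt; have := active_short li ai; case: (posnP (S1 i)) => // p.
  by have := r1 _ li p; lia.
have S20 i t : ~~ is_long i -> active I i t -> t != x -> S2 i = 0%N.
  move=> li ai xt; have := active_short li ai; case: (posnP (S2 i)) => // p.
  by have := r2 _ li p; lia.
split.
- move=> t; rewrite nshort_madd3 n3 addn0.
  have [->|tx] := eqVneq t x.
    by rewrite (nshort_eq0 (S := S1)) ?add0n // => i li ai; exact: S10 ai _.
  by rewrite (nshort_eq0 (S := S2)) ?addn0 // => i li ai; exact: S20 ai _.
- move=> i li; rewrite ffunE S30 addn0 addn_gt0 => /orP[/(r1 _ li)|/(r2 _ li)]; lia.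
exists (fun t => if t == x then q2 else Q t); split; last first.
  rewrite big_nat_recr //= eqxx leq_add2r (leq_trans qQ) // big_nat [leqRHS]big_nat leq_sum //.
  by move=> t tx; case: eqP; lia.
move=> t tax; rewrite /reach short_cap_madd3 k3 addr0; case: eqP => [->|tx].
  split=> //; left; rewrite (short_cap_eq0 (S := S1)); first by lia.
  by move=> i li ai; exact: S10 ai _.
have [|qd hq] := hQ t; first by lia.
split=> //.
rewrite (short_cap_eq0 (S := S2)) ?addr0; last by move=> i li ai; apply: S20 ai _ => //;
    apply/eqP.
case: hq => [hq|[i [li ai hq]]]; first by left.
have [|?|?] := @grow_copies _ _ _ _ (madd3 S1 S2 S3 i) h hq; [by rewrite ffunE; lia| |by left].
by right; exists i.
Qed.

Lemma valid_rule a b h x g q1 q2 i f d s1 s2 s3 S1 S2 S3 :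
  rule a b h x g q1 q2 i f d s1 s2 s3 ->
  valid s1 S1 -> valid s2 S2 -> valid s3 S3 -> valid d (madd3 S1 S2 S3).
Proof.
case=> {d s1 s2 s3}.
- by move=> _ /= h1 h2 h3 j; rewrite ffunE h1 h2 h3; lia.
- move=> a0 /valid_origin h1 /valid_origin h2 /valid_origin h3 /=.
  have S0 j : madd3 S1 S2 S3 j = 0%N by rewrite ffunE h1 h2 h3.
  rewrite eqn0Ngt a0 /=; split.
  + by move=> t; rewrite nshort_eq0.
  + by move=> j _; rewrite S0.
  by exists (fun=> 0%N); split=> [t|//]; lia.
- move=> ax -> _ q2d q2h h1 /valid_origin h2 /valid_origin h3.
  by apply: valid_slot => //; rewrite ?nshort_eq0 ?short_cap_eq0 ?addr0 // => j; rewrite h2.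
- move=> j -> sj sx ax -> _ q2d q2h h1 /= h2 /valid_origin h3.
  have act : active I j x by have := shortP sj; rewrite /active; lia.
  have unq k : ~~ is_long k -> active I k x -> k != j -> S2 k = 0%N.
    by move=> _ _ /eqP kj; rewrite h2; case: eqP => // /val_inj.
  apply: valid_slot => //.
  + by move=> k _; rewrite h2; case: eqP => [/val_inj -> //|].
  + rewrite /nshort (bigD1 j) ?sj //= big1 ?addn0 ?h2 ?eqxx //.
    by move=> k /andP[/andP[? ?] ?]; apply: unq.
  rewrite /short_cap (bigD1 j) ?sj //= big1 ?addr0; last first.
    by move=> k /andP[/andP[? ?] ?]; rewrite unq // mulr0.
  by rewrite h2 eqxx mulr1.
move=> j -> lj /andP[a0 ax] xb sx bf gw _ /= + h2; have x0 : (0 < x)%N by lia.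
rewrite !eqn0Ngt a0 x0 /= => -[c1 r1 [Q1 [hQ1 qQ1]]] [c3 r3 [Q3 [hQ3 qQ3]]].
have S20 k t : ~~ is_long k -> active I k t -> S2 k = 0%N.
  move=> lk _; rewrite h2; case: eqP => // /val_inj kj; by rewrite kj lj in lk.
have n2 t : nshort S2 t = 0%N by apply: nshort_eq0 => k lk ak; exact: S20 lk ak.
have k2 t : short_cap S2 t = 0 by apply: short_cap_eq0 => k lk ak; exact: S20 lk ak.
have S10 k t : ~~ is_long k -> active I k t -> (x <= t)%N -> S1 k = 0%N.
  move=> lk ak xt; have := active_short lk ak; case: (posnP (S1 k)) => // p.
  by have := r1 _ lk p; lia.
have S30 k t : ~~ is_long k -> active I k t -> (t < x)%N -> S3 k = 0%N.
  move=> lk ak xt; have := active_short lk ak; case: (posnP (S3 k)) => // p.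
  by have := r3 _ lk p; lia.
split.
- move=> t; rewrite nshort_madd3 n2 addn0; have [xt|tx] := leqP x t.
    by rewrite (nshort_eq0 (S := S1)) ?add0n // => k lk ak; exact: S10 ak _.
  by rewrite (nshort_eq0 (S := S3)) ?addn0 // => k lk ak; exact: S30 ak _.
- move=> k lk; rewrite ffunE => Sk.
  have := r1 _ lk; have := r3 _ lk; have : S2 k = 0%N by apply: (S20 k (start k)) => //;
      have := shortP lk; rewrite /active; lia.
  by case: (posnP (S1 k)); case: (posnP (S3 k)); lia.
exists (fun t => if (t < x)%N then Q1 t else Q3 t); split; last first.
  rewrite (big_cat_nat ax xb) /= leq_add //.
    by apply: leq_trans qQ1 _; rewrite big_nat [leqRHS]big_nat leq_sum // => t /andP[_ ->].
  apply: leq_trans qQ3 _; rewrite big_nat [leqRHS]big_nat leq_sum // => t /andP[xt _].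
  by rewrite ltnNge xt.
move=> t tab; rewrite /reach short_cap_madd3 k2 addr0; have [tx|xt] := ltnP t x.
  have [|qd hq] := hQ1 t; first by lia.
  split=> //; rewrite (short_cap_eq0 (S := S3)) ?addr0; last by move=> k lk ak; exact: S30 ak _.
  case: hq => [hq|[k [lk ak hq]]]; first by left.
  have [|?|?] := @grow_copies _ _ _ _ (madd3 S1 S2 S3 k) h hq; [by rewrite ffunE; lia| |by left].
  by right; exists k.
have [|qd hq] := hQ3 t; first by lia.
split=> //; rewrite (short_cap_eq0 (S := S1)) ?add0r; last by move=> k lk ak; exact: S10 ak _.
(* A slot of the right part served by its base [g] is served by the [f] copies of [j], which is
   active on all of [[x,b)]. *)
have base v : v <= short_cap S3 t + g%:Z -> v <= short_cap S3 t + h%:Z \/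
    exists k, [/\ is_long k, active I k t & v <= short_cap S3 t + capacity k * (madd3 S1 S2 S3
        k)%:Z].
  move=> vg; have {}vg : v <= short_cap S3 t + capacity j * f%:Z by lia.
  have [||] := @grow_copies _ _ _ _ (madd3 S1 S2 S3 j) h vg; [by rewrite ffunE h2 eqxx;
      lia| |by left].
  by right; exists j; split=> //; rewrite /active; lia.
case: hq => [/base //|[k [lk ak hq]]].
(* The fallback is the base [g], not [h]: if the capacity of [k] is negative, the slot relies on the
   copies of [j]. *)
have [||] := @grow_copies _ _ _ _ (madd3 S1 S2 S3 k) g hq; [by rewrite ffunE; lia| |exact: base].
by right; exists k.
Qed.

Lemma derivableS r p c : derivable r p c -> derivable r.+1 p c.
Proof.
elim=> {r p c} [r|r j|r *]; [exact: derivable_origin|exact: derivable_unit|].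
by apply: derivable_step; eassumption.
Qed.

Lemma derivable_le r r' p c : (r <= r')%N -> derivable r p c -> derivable r' p c.
Proof. by move=> /subnK <-; elim: (r' - r)%N => // k IH /IH; exact: derivableS. Qed.

Definition long_support S := [set i | is_long i & (0 < S i)%N].

Definition select (P : pred 'I_n) S : {ffun 'I_n -> nat} :=
  [ffun i => if P i then S i else 0%N].

Lemma cost_select P S : multiset_cost I (select P S) = \sum_(i | P i) cost i *+ S i.
Proof.
rewrite /multiset_cost [RHS]big_mkcond; apply: eq_bigr => i _ /=.
by rewrite ffunE; case: ifP.
Qed.

Lemma short_cap_select (P : pred _) S t :
  (forall i, ~~ is_long i -> active I i t -> P i) -> short_cap (select P S) t = short_cap S t.
Proof. by move=> h; apply: eq_bigr => i /andP[li ai]; rewrite ffunE h. Qed.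

Lemma nshort_select P S t : (nshort (select P S) t <= nshort S t)%N.
Proof. by apply: leq_sum => i _; rewrite ffunE; case: ifP. Qed.

(** Both parts of a split are restrictions of [S] to a set of resources. Goodness is inherited; the
    place of the short resources and the profile are to be checked again. *)
Lemma valid_select (P : pred _) S a b h q a' b' g q' (Q : nat -> nat) :
  valid (a, b, h, q) S -> (0 < a)%N -> (0 < a')%N ->
  (forall i, ~~ is_long i -> P i -> (a <= start i < b)%N -> (a' <= start i < b')%N) ->
  (forall t, (a' <= t < b')%N -> reach g (select P S) t (Q t)) ->
  (q' <= \sum_(a' <= t < b') Q t)%N -> valid (a', b', g, q') (select P S).
Proof.
move=> + a0 a0'; rewrite /= !eqn0Ngt a0 a0' /= => -[c r _] hP hQ qQ; split; last by exists Q.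
- by move=> t; apply: leq_trans (nshort_select _ _ _) (c t).
- by move=> i li; rewrite ffunE; case: ifP => // Pi Si; apply: hP => //; apply: r.
Qed.

Lemma short_slot S t : (nshort S t <= 1)%N ->
  short_cap S t = 0 \/
  exists j, [/\ ~~ is_long j, active I j t, S j = 1%N & short_cap S t = capacity j].
Proof.
move=> c; have [j /andP[/andP[lj aj] Sj]|no] :=
    pickP [pred i | (~~ is_long i && active I i t) && (0 < S i)%N]; last first.
  left; apply: short_cap_eq0 => i li ai; have /= := no i.
  by rewrite li ai; case: (S i).
right; exists j; move: c; rewrite /nshort (bigD1 j) ?lj //= => c.
have Sj1 : S j = 1%N by move: Sj c => /=; lia.
have S0 i : ~~ is_long i -> active I i t -> i != j -> S i = 0%N.
  move=> li ai ij; move: c; rewrite (bigD1 i) ?li ?ai //= Sj1; lia.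
split=> //; rewrite /short_cap (bigD1 j) ?lj //= big1 ?Sj1 ?mulr1 ?addr0 //.
by move=> i /andP[/andP[li ai] ij]; rewrite S0 // mulr0.
Qed.

Lemma long_support_select (P : pred _) S : (#|long_support (select P S)| <= #|long_support S|)%N.
Proof.
by apply: subset_leq_card; apply/subsetP => i; rewrite !inE ffunE; case: ifP; rewrite ?andbF.
Qed.

Hypothesis B_gt1 : (1 < B)%N.
Hypothesis n_ltB : (n < B)%N.
Hypothesis dem_ltB : forall t, (dem t < B)%N.

Lemma derivable_copies (j : 'I_n) f :
  (0 < f < B)%N -> derivable f (0, 0, j : nat, f) (cost j *+ f).
Proof.
elim: f => // -[_ _|f IH fB]; first exact: derivable_unit.
have -> : cost j *+ f.+2 = cost j *+ f.+1 + cost j + 0 by rewrite addr0 mulrSr.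
apply: (@derivable_step _ 0 0 0 0 0 0 0 j f.+1); last 3 first.
- by apply: IH; lia.
- exact: derivable_unit.
- exact: derivable_origin.
- by have := ltn_ord j; rewrite /=; lia.
by apply: rule_copy; lia.
Qed.

Lemma derivable_empty r a h : (0 < a < B)%N -> (h < B)%N -> derivable r.+1 (a, a, h, 0) 0.
Proof.
move=> aB hB; have -> : 0 = 0 + 0 + 0 :> R by rewrite !addr0.
apply: (@derivable_step _ a a h 0 0 0 0 0 0); try exact: derivable_origin.
  by rewrite /=; lia.
by apply: rule_empty; lia.
Qed.

(** [B] rounds build the copies of single resources; every further round can use
    points at which the measure [m] is smaller. *)
Lemma valid_derivable m a b h q S :
  (0 < a <= b)%N -> (b < B)%N -> (h < B)%N -> (q < B)%N ->
  (b - a + #|long_support S| <= m)%N ->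
  (forall i, ~~ is_long i -> (0 < S i)%N -> 0 <= capacity i) ->
  valid (a, b, h, q) S ->
  exists c, derivable (B + m).+1 (a, b, h, q) c /\ c <= multiset_cost I S.
Proof.
elim: m a b h q S => [|m IH] a b h q S ab bB hB qB hm pos vS.
all: have [a0 leab] := andP ab.
all: have cost0 : 0 <= multiset_cost I S by apply: sumr_ge0 => i _;
    rewrite mulrn_wge0 // cost_ge0.
all: have vS' := vS; move: vS'; rewrite /= eqn0Ngt a0 => /= -[cS rS [Q [hQ qQ]]].
all: have [eab|neab] := eqVneq a b.
1, 3: by move: qQ; rewrite -eab big_geq // leqn0 => /eqP ->; exists 0; split=> //;
  apply: derivable_empty => //; lia.
  by lia.
have [y yb] : exists y, b = y.+1 by exists b.-1; lia.
pose ht i := capacity i * (S i)%:Z.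
have posS P i : ~~ is_long i -> (0 < select P S i)%N -> 0 <= capacity i.
  by move=> li; rewrite ffunE; case: ifP => // _; apply: pos.
have [i0 /and3P[li0 ai0 hi0]|low] := pickP [pred i | [&& is_long i, active I i y & h%:Z < ht
    i]]; last first.
  have lowQ : (Q y)%:Z <= short_cap S y + h%:Z.
    have [|_ [//|[i [li ai hi]]]] := hQ y; first by lia.
    by have := low i; rewrite /= li ai /= /ht; lia.
  have yd : (Q y <= dem y)%N by have [|] := hQ y; lia.
  have [q1 [q2 [q12 q1Q q2y]]] : exists q1 q2,
      [/\ q = (q1 + q2)%N, (q1 <= \sum_(a <= t < y) Q t)%N & (q2 <= Q y)%N].
    by apply: leq_addP; rewrite -big_nat_recr -?yb //; lia.
  (* This set contains every resource active before [y] but no short resource at [y], whose cost is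
     thus left over for the rule. *)
  pose P := [pred i : 'I_n | (start i < y)%N].
  have [c1 [d1 c1S]] : exists c, derivable (B + m).+1 (a, y, h, q1) c /\ c <= multiset_cost I
      (select P S).
    apply: IH; [by lia|by lia|by []|by lia|by have := long_support_select P S; lia|exact: posS|].
    apply: (valid_select vS (Q := Q)) => //.
      by move=> i _ /= iy; lia.
    move=> t t_in; have [|qd hq] := hQ t; first by lia.
    have Pi i : active I i t -> P i by rewrite /active /=; lia.
    split=> //; rewrite short_cap_select => [|i _]; last exact: Pi.
    case: hq => [?|[i [li ai hi]]]; [by left|right].
    by exists i; rewrite ffunE Pi.
  have split_cost : multiset_cost I S =
      multiset_cost I (select P S) + \sum_(i | ~~ P i) cost i *+ S i.
    by rewrite cost_select /multiset_cost (bigID P).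
  have rest0 : 0 <= \sum_(i | ~~ P i) cost i *+ S i.
    by apply: sumr_ge0 => i _; rewrite mulrn_wge0 // cost_ge0.
  have [sc0|[j [lj aj Sj scj]]] := short_slot (cS y).
    exists (c1 + 0 + 0); split; last by rewrite !addr0 split_cost ler_wpDr.
    rewrite q12 addnS; apply: (@derivable_step _ a b h y 0 q1 q2 0 0);
        try exact: derivable_origin.
    - by rewrite /=; lia.
    - by apply: rule_none; lia.
    by [].
  have sj := active_short lj aj.
  exists (c1 + cost j + 0); split.
    rewrite q12 addnS; apply: (@derivable_step _ a b h y 0 q1 q2 j 1);
        try exact: derivable_origin.
    - by have := ltn_ord j; rewrite /=; lia.
    - by apply: (@rule_short _ _ _ _ _ _ _ _ _ j); rewrite //; lia.
    - by [].
    exact: derivable_unit.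
  rewrite addr0 split_cost lerD // (bigD1 j) /=; last by lia.
  rewrite Sj lerDl; apply: sumr_ge0 => i _; rewrite mulrn_wge0 // cost_ge0 //.
have Pi0 : is_long i0 && active I i0 y by rewrite li0.
case: (@arg_maxP _ _ _ i0 (fun i => is_long i && active I i y) ht Pi0) => j /andP[lj ajy] jmax;
    have {}hi0 : h%:Z < ht j by apply: lt_le_trans hi0 (jmax i0 Pi0).
pose top t := [&& (a <= t < b)%N, active I j t & [forall i, is_long i && active I i t ==> (ht i
    <= ht j)]].
have topy : top y.
  by rewrite /top ajy andTb yb ltnSn andbT -ltnS -yb ltn_neqAle neab leab; apply/forallP => i;
      apply/implyP => /jmax.
case: (ex_minnP (ex_intro top y topy)) => x /and3P[xab ajx /forallP jx] xmin.
have {}jx i : is_long i -> active I i x -> ht i <= ht j by move=> li ai; have := jx i;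
    rewrite li ai.
have {}xmin t : (a <= t < x)%N -> active I j t -> exists i, [/\ is_long i, active I i t & ht j
    < ht i].
  move=> tax ajt; have [i /andP[/andP[li ai] hi]|no] := pickP [pred i | is_long i && active I i
      t && (ht j < ht i)].
    by exists i.
  suff /xmin : top t by lia.
  rewrite /top ajt; apply/andP; split; first by lia.
  by apply/forallP => i; apply/implyP => ai; have := no i; rewrite /= ai leNgt => /= ->.
have xy : (x <= y)%N by lia.
have cj : 0 < capacity j by case: (ltrP 0 (capacity j)) hi0 => // c0;
    have : ht j <= 0 by [rewrite /ht mulr_le0_ge0]; lia.
(* Table indices stop at [B - 1]. Demands are below [B], so a base of height [B - 1] is as good as
   any higher one. *)
pose f := minn B.-1 (S j); pose g := minn B.-1 `|ht j|%N.
have htE : ht j = `|ht j|%N by lia.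
have gf : g%:Z <= capacity j * f%:Z.
  rewrite /g /f; case: (leqP B.-1 (S j)) => SB; last by rewrite -/(ht j); lia.
  (* The capacity of [j] is at least 1, so [B - 1] copies reach height [B - 1], which bounds [g]. *)
  apply: (@le_trans _ _ (1 * (B.-1)%:Z)); first by lia.
  by rewrite ler_wpM2r //; lia.
have hg : (h <= g)%N by rewrite /g; lia.
have gB : (g < B)%N by rewrite /g; lia.
have htg v u : (v < B)%N -> 0 <= u -> v%:Z <= u + ht j -> v%:Z <= u + g%:Z.
  by rewrite htE /g; lia.
have Sj0 : (0 < S j)%N by case: (posnP (S j)) hi0 => //; rewrite /ht => ->; rewrite mulr0; lia.
have fB : (0 < f < B)%N by rewrite /f; lia.
have fS : (f <= S j)%N by rewrite /f; lia.
clearbody f g; clear htE hi0 topy neab ab Pi0 li0 ai0 cost0.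
(* The resource [j] belongs to neither part, so the long support shrinks even if [x = a] and the
   range does not. *)
pose L := [pred i | (i != j) && (start i < x)%N];
    pose U := [pred i | (i != j) && (x <= start i)%N].
have lower P : ~~ P j -> (#|long_support (select P S)| < #|long_support S|)%N.
  move=> Pj; apply: proper_card; apply/properP; split.
    by apply/subsetP => i; rewrite !inE ffunE; case: ifP; rewrite ?andbF.
  by exists j; rewrite !inE ?ffunE ?(negPf Pj) ?andbF ?lj.
have jL : ~~ L j by rewrite /= eqxx.
have jU : ~~ U j by rewrite /= eqxx.
have neqj i : ~~ is_long i -> i != j by apply: contraNneq => ->.
have [q1 [q2 [q12 q1Q q2x]]] : exists q1 q2,
    [/\ q = (q1 + q2)%N, (q1 <= \sum_(a <= t < x) Q t)%N & (q2 <= \sum_(x <= t < b) Q t)%N].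
  by apply: leq_addP; rewrite -big_cat_nat //; [case/andP: xab|apply: leq_trans xy _; rewrite yb].
clear qQ.
have [c1 [d1 c1S]] : exists c, derivable (B + m).+1 (a, x, h, q1) c /\ c <= multiset_cost I
    (select L S).
  apply: IH; [by lia|by lia|by []|by lia|by have := lower L jL; lia|exact: posS|].
  apply: (valid_select vS (Q := Q)) => //.
    by move=> i _ /andP[_ ix]; lia.
  move=> t t_in; have [|qd hq] := hQ t; first by lia.
  have Li i : i != j -> active I i t -> L i by rewrite /active /= => -> /=; lia.
  split=> //; rewrite short_cap_select => [|i /neqj]; last exact: Li.
  case: hq => [?|[i [li ai hi]]]; [by left|right].
  have [ij|ij] := eqVneq i j; last by exists i; rewrite ffunE Li.
  (* Before [x], minimality supplies a resource strictly higher than [j]; being active at [t < x],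
     it belongs to [L]. *)
  rewrite ij in ai hi; have [||k [lk ak jk]] := xmin t; [by lia|by []|].
  exists k; rewrite ffunE Li //; last by apply: contraTneq jk => ->; rewrite ltxx.
  by split=> //; apply: le_trans hi _; rewrite lerD2l ltW.
have [c3 [d3 c3S]] : exists c, derivable (B + m).+1 (x, b, g, q2) c /\ c <= multiset_cost I
    (select U S).
  apply: IH; [by lia|by []|by lia|by lia|by have := lower U jU; lia|exact: posS|].
  apply: (valid_select vS (Q := Q)) => //; first by lia.
    by move=> i _ /andP[_ ix]; lia.
  move=> t t_in; have [|qd hq] := hQ t; first by lia.
  have Ui i : i != j -> active I i t -> ~~ is_long i -> U i.
    by rewrite /= => -> ai li; rewrite -(active_short li ai); case/andP: t_in.
  split=> //; rewrite short_cap_select => [|i li ai]; last by apply: Ui => //; exact: neqj.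
  (* This makes the truncation of [g] harmless: a demand is at most [B - 1], hence at most the short
     capacity plus [B - 1]. *)
  have sc0 : 0 <= short_cap S t.
    apply: sumr_ge0 => i /andP[li _]; case: (posnP (S i)) => [->|/(pos i li) ?];
        first by rewrite mulr0.
    by rewrite mulr_ge0.
  case: hq => [?|[i [li ai hi]]]; first by left; lia.
  have [Ui'|Ui'] := boolP (U i); first by right; exists i; rewrite ffunE Ui'.
  (* An active long resource outside [U] is [j] itself or started before [x]. In the latter case it
     is active at [x], where [j] is highest, so the base [g] replaces it. *)
  left; apply: htg => //; [by apply: leq_ltn_trans qd _|apply: le_trans hi _;
      rewrite lerD2l -/(ht i)].
  have [->//|ij] := eqVneq i j; apply: jx => //.
  by move: Ui' ai; rewrite /= ij /active /=; lia.
exists (c1 + cost j *+ f + c3); split.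
  rewrite q12 addnS; apply: (@derivable_step _ a b h x g q1 q2 j f) => //.
  - by have := ltn_ord j; rewrite /=; lia.
  - by apply: (@rule_long _ _ _ _ _ _ _ _ _ j); move: ajx ajy; rewrite // /active; lia.
  - exact: d1.
  - by apply: (@derivable_le f); [lia|exact: derivable_copies].
  exact: d3.
have -> : multiset_cost I S =
    multiset_cost I (select L S) + cost j *+ S j + multiset_cost I (select U S).
  rewrite !cost_select /multiset_cost (bigD1 j) //= (bigID (fun i => start i < x)%N) /=.
  rewrite addrA (addrC (cost j *+ _)); congr (_ + _).
  by apply: eq_bigl => i; rewrite -leqNgt.
by rewrite !lerD // -[S j](subnK fS) mulrnDr lerDr mulrn_wge0 // cost_ge0.
Qed.

End Rules.

(** * From the whole horizon to SLRA solutions and back *)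

Definition need : nat := if target I is Posz k then k else 0%N.

Definition whole : point := (1%N, (horizon I).+1, 0%N, need).

Lemma need_ge : target I <= need%:Z.
Proof. by rewrite /need; case: (target I). Qed.

Lemma short_profileE S t : (nshort S t <= 1)%N -> short_profile I S t = short_cap S t.
Proof.
move=> cS; rewrite /short_profile; case: pickP => [i /and3P[li ai Si]|no]; last first.
  by rewrite short_cap_eq0 // => i li ai; have := no i; rewrite li ai /=; case: (S i).
move: cS; rewrite /nshort /short_cap !(bigD1 (P := fun i => ~~ is_long i && _) i) ?li //= => cS.
have Si1 : S i = 1%N by lia.
rewrite Si1 mulr1 big1 ?addr0 // => k /andP[/andP[lk ak] ki]; move: cS.
by rewrite (bigD1 k) ?lk ?ak //= Si1; case: (S k); rewrite ?mulr0 //; lia.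
Qed.

(** The surplus over the target is subtracted at slot 1; lowering a profile only weakens the cover
    condition. On an empty horizon the covered amount is 0, so a nonnegative target is 0 and there
    is no surplus. *)
Lemma valid_solution S :
  (0 < horizon I)%N \/ 0 <= target I -> valid whole S -> slra_solution I S.
Proof.
move=> hT [cS rS [Q [hQ qQ]]];
    pose excess := (\sum_(1 <= t < (horizon I).+1) Q t)%N%:Z - target I.
have ex0 : 0 <= excess by have := need_ge; rewrite /excess; lia.
pose Q' t : int := (Q t)%:Z - (if t == 1%N then excess else 0).
have Q'Q t : Q' t <= (Q t)%:Z by rewrite /Q'; case: ifP; lia.
exists Q'; split.
- move=> t tT; apply: le_trans (Q'Q t) _; have [|] := hQ t; first by lia.
  by rewrite /dem; case: ifP; lia.
- rewrite /measure sumrB -(big_morph Posz PoszD (erefl 0%:Z)).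
  case: (posnP (horizon I)) hT qQ => [T0|T0] hT qQ.
    by move: qQ; rewrite T0 !big_geq // /need; move: hT; case: (target I); lia.
  have -> : \sum_(1 <= t < (horizon I).+1) (if t == 1%N then excess else 0) = excess.
    by rewrite big_ltn // big_nat big1 ?addr0 // => t; case: eqP => // ->.
  by rewrite /excess; lia.
split=> [t _|t tT]; rewrite ?short_profileE //; first exact: cS.
move=> Qpos; have le := Q'Q t; have [|_ [hq|[i [li ai hq]]]] := hQ t; [by lia|by lia|].
exists i; split=> //; last by lia.
by case: (posnP (S i)) hq => // ->; rewrite mulr0; lia.
Qed.

(** These conditions justify the tests of [output]: the first keeps [need] below [B], the second
    rejects a negative target on an empty horizon. *)
Lemma solution_target S : slra_solution I S ->
  target I <= dsum%:Z /\ (horizon I = 0%N -> target I = 0).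
Proof.
case=> Q [pQ <- _]; rewrite /measure; split=> [|->]; last by rewrite big_geq.
rewrite /dsum (big_morph Posz PoszD (erefl 0%:Z)).
by apply: ler_sum_nat => t tT; apply: pQ; lia.
Qed.

(** Discarding short resources of negative capacity only raises the short profile and, costs being
    nonnegative, does not raise the cost. Negative profile values become 0, which is then reached
    from base 0. *)
Lemma solution_valid S : slra_solution I S -> exists S',
  [/\ valid whole S', forall i, ~~ is_long i -> (0 < S' i)%N -> 0 <= capacity i
    & multiset_cost I S' <= multiset_cost I S].
Proof.
case=> Q [pQ mQ [gS cov]].
have gS' t : (nshort S t <= 1)%N.
  have [tT|tT] := boolP (0 < t <= horizon I)%N; first exact: gS.
  rewrite nshort_eq0 // => i li ai; have := intervalP i; move: ai tT; rewrite /active; lia.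
pose P := [pred i : 'I_n | is_long i || (0 <= capacity i)].
exists (select P S); split; last 1 first.
- rewrite cost_select /multiset_cost [leRHS](bigID P) /= lerDl.
  by apply: sumr_ge0 => i _; rewrite mulrn_wge0 // cost_ge0.
2: by move=> i li; rewrite ffunE /= (negPf li) /=; case: ifP.
have sc t : short_cap S t <= short_cap (select P S) t /\ 0 <= short_cap (select P S) t.
  split; [apply: ler_sum|apply: sumr_ge0] => i /andP[li _]; rewrite ffunE /= (negPf li) /=.
    by case: (lerP 0 (capacity i)) => // ci; rewrite mulr0 mulr_le0_ge0 // ltW.
  by case: ifP => [?|_]; rewrite ?mulr0 // mulr_ge0.
split; first by move=> t; apply: leq_trans (nshort_select _ _ _) (gS' t).
  by move=> i li _; have := intervalP i; have := shortP li; lia.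
exists (fun t => if Q t is Posz k then k else 0%N); split; last first.
  suff : target I <= (\sum_(1 <= t < (horizon I).+1) (if Q t is Posz k then k else 0%N))%N%:Z.
    by rewrite /need; case: (target I) => k; lia.
  rewrite -mQ /measure (big_morph Posz PoszD (erefl 0%:Z)); apply: ler_sum => t _.
  by case: (Q t).
move=> t tT; have := pQ t; have := cov t; have [sc1 sc2] := sc t.
rewrite (short_profileE (gS' t)); case: (Q t) => [k|k]; last by split=> //; left; lia.
move=> covt dt; split; first by rewrite /dem; case: ifP; lia.
case: (lerP (k%:Z - short_cap S t) 0) => ks; first by left; lia.
right; have [||i [li Si ai hi]] := covt; [by lia|by []|].
by exists i; rewrite ffunE /= li /=; split=> //; lia.
Qed.

End Subproblems.

(** * Control structures of the program *)

(** Scalar [k] lives in cell [k] of integer array 19; scalar 0 is the bound [B] of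
    the loops, scalars 2 to 10 are the parameters of [rule], and 11 to 14 are the
    addresses of the points in a rule. The table entry at address [e] has its
    flag in cell [e] of integer array 10, its cost in cell [e] of cost array 1,
    and its vector in cells [e + j * B ^ 4] of array 11. Arrays [12 + k] tabulate
    [x * B ^ k], there being no multiplication. *)
Definition var (k : nat) : iexp := IGet 19 (IConst k%:Z).
Definition setv (k : nat) (e : iexp) : cmd := ISet 19 (IConst k%:Z) e.
Definition ilt (e1 e2 : iexp) : bexp := BNot (ILe e2 e1).
Definition succ (e : iexp) : iexp := IAdd e (IConst 1).

Definition for_ (k : nat) (e : iexp) (body : cmd) : cmd :=
  Seq (setv k (IConst 0)) (While (ilt (var k) e) (Seq body (setv k (succ (var k))))).

Fixpoint nest (k m : nat) (body : cmd) : cmd :=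
  if m is m'.+1 then for_ k (var 0) (nest k.+1 m' body) else body.

(** * Logic of terminating runs with time bounds *)

Section Logic.
Variable R : realDomainType.
Implicit Types (s : state R) (Q : state R -> Prop).

Definition iset s a z v : state R := State (upd (imem s) a z v) (cmem s).
Definition cset s a z v : state R := State (imem s) (upd (cmem s) a z v).
Definition sset s (k : nat) (v : int) : state R := iset s 19 k%:Z v.

(** The number [n] only bounds the steps, so that branches of different lengths share one bound. *)
Definition runs (p : cmd) s (n : nat) Q : Prop :=
  exists m s', [/\ exec p s m s', (m <= n)%N & Q s'].

Lemma runs_weaken p s n n' Q Q' :
  runs p s n Q -> (n <= n')%N -> (forall s', Q s' -> Q' s') -> runs p s n' Q'.
Proof.
move=> [m [s' [e mn q]]] nn qq; exists m, s'; split=> //; last exact: qq.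
exact: leq_trans mn nn.
Qed.

Lemma runs_skip s Q : Q s -> runs Skip s 1 Q.
Proof. by exists 1%N, s; split=> //; constructor. Qed.

Lemma runs_iset s a e v Q :
  Q (iset s a (ieval s e) (ieval s v)) -> runs (ISet a e v) s 1 Q.
Proof. by exists 1%N; eexists; split; [constructor| |]. Qed.

Lemma runs_setv s k v Q : Q (sset s k (ieval s v)) -> runs (setv k v) s 1 Q.
Proof. exact: runs_iset. Qed.

Lemma runs_cset s a e v Q :
  Q (cset s a (ieval s e) (ceval s v)) -> runs (CSet a e v) s 1 Q.
Proof. by exists 1%N; eexists; split; [constructor| |]. Qed.

Lemma runs_seq p1 p2 s n1 n2 Q :
  runs p1 s n1 (fun s' => runs p2 s' n2 Q) -> runs (Seq p1 p2) s (n1 + n2) Q.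
Proof.
move=> [m1 [s1 [e1 l1 [m2 [s2 [e2 l2 q]]]]]]; exists (m1 + m2)%N, s2; split=> //.
  exact: ExecSeq e1 e2.
exact: leq_add.
Qed.

Lemma runs_if b p1 p2 s n Q :
  (beval s b -> runs p1 s n Q) -> (~~ beval s b -> runs p2 s n Q) ->
  runs (If b p1 p2) s n.+1 Q.
Proof.
case: (boolP (beval s b)) => hb h1 h2.
  have [m [s' [e l q]]] := h1 isT; exists m.+1, s'; split=> //; exact: ExecIfTrue.
have [m [s' [e l q]]] := h2 isT; exists m.+1, s'; split=> //; exact: ExecIfFalse.
Qed.

(** [J x] describes the state at the test with counter [x]. The bound is evaluated anew at each
    test, hence must keep the value [N] under [J]. The leading 2 is the first assignment and the
    last test; each iteration adds a test and an increment to the body. *)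
Lemma runs_for k e N body n s (J : nat -> state R -> Prop) :
  (forall x s', J x s' -> ieval s' e = N%:Z /\ imem s' 19 k%:Z = x%:Z) ->
  J 0 (sset s k 0) ->
  (forall x s', (x < N)%N -> J x s' ->
     runs body s' n (fun s'' => imem s'' 19 k%:Z = x%:Z /\ J x.+1 (sset s'' k x.+1%:Z))) ->
  runs (for_ k e body) s (2 + N * (n + 2)) (J N).
Proof.
move=> Jval J0 Jstep; apply: (@runs_seq _ _ _ 1 (1 + N * (n + 2))); apply: runs_setv.
suff loop d x s' : (x + d = N)%N -> J x s' ->
    runs (While (ilt (var k) e) (Seq body (setv k (succ (var k))))) s' (1 + d * (n + 2)) (J N).
  by apply: loop J0.
elim: d x s' => [|d IH] x s' xd Jx; have [eN kx] := Jval _ _ Jx.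
  exists 1%N, s'; split=> //; last by rewrite -xd addn0.
  by apply: ExecWhileFalse; rewrite /= eN kx -xd addn0 lexx.
have [|m1 [s1 [e1 l1 [k1 J1]]]] := Jstep _ _ _ Jx; first by lia.
have [|m2 [s2 [e2 l2 q]]] := IH x.+1 _ _ J1; first by lia.
exists (m1 + 1 + m2).+1, s2; split=> //; last by lia.
apply: ExecWhileTrue e2; first by rewrite /= eN kx; lia.
apply: ExecSeq e1 _; have -> : x.+1%:Z = ieval s1 (succ (var k)) by rewrite /= k1; lia.
exact: ExecISet.
Qed.

(** The list is the loop bound followed by the counters of the enclosing loops; scalars beyond it
    are free. *)
Definition vars (l : seq nat) s : Prop :=
  forall k, (k < size l)%N -> imem s 19 k%:Z = (nth 0%N l k)%:Z.

Lemma imem_iset s a z v a' z' :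
  imem (iset s a z v) a' z' = if (a' == a) && (z' == z) then v else imem s a' z'.
Proof. by []. Qed.

Lemma imem_iset_eq s a z v z' :
  imem (iset s a z v) a z' = if z' == z then v else imem s a z'.
Proof. by rewrite imem_iset eqxx. Qed.

Lemma imem_iset_neq s a z v a' z' : a' != a -> imem (iset s a z v) a' z' = imem s a' z'.
Proof. by rewrite imem_iset => /negPf ->. Qed.

Lemma imem_cset s a z v : imem (cset s a z v) = imem s.
Proof. by []. Qed.

Lemma imem_sset s k v k' :
  imem (sset s k v) 19 k'%:Z = if k' == k then v else imem s 19 k'%:Z.
Proof. by rewrite imem_iset eqxx. Qed.

Lemma vars_cat l l' s : vars (l ++ l') s -> vars l s.
Proof. by move=> h k kl; rewrite h ?size_cat ?nth_cat ?kl // ltn_addr. Qed.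

Lemma vars_eq l s s' :
  (forall k, (k < size l)%N -> imem s' 19 k%:Z = imem s 19 k%:Z) -> vars l s -> vars l s'.
Proof. by move=> e h k kl; rewrite e ?h. Qed.

Lemma vars_sset l s k v : (size l <= k)%N -> vars l s -> vars l (sset s k v).
Proof. by move=> lk; apply: vars_eq => k' k'l; rewrite imem_sset; case: eqP; lia. Qed.

Lemma vars_rcons l s x : vars l s -> imem s 19 (size l)%:Z = x%:Z -> vars (rcons l x) s.
Proof.
move=> h hx k; rewrite size_rcons nth_rcons ltnS leq_eqVlt => /orP[/eqP ->|kl].
  by rewrite ltnn eqxx.
by rewrite kl h.
Qed.

Section Nest.
Variables (B : nat) (Inv : state R -> Prop) (M : state R -> state R -> Prop).
Hypothesis M_refl : forall s, M s s.
Hypothesis M_trans : forall s1 s2 s3, M s1 s2 -> M s2 s3 -> M s1 s3.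
Hypothesis Inv_sset : forall s k v, Inv s -> Inv (sset s k v).
Hypothesis M_sset : forall s k v, M s (sset s k v).

Definition nest_time n m := iter m (fun t => 2 + B * (t + 2))%N n.

(** Each iteration establishes [P] at its own counters, and stability under the preorder [M] carries
    it to the end of the nest, where [P] thus holds at all tuples of counters together. *)
Lemma runs_nest m body n (P : seq nat -> state R -> Prop) l s :
  (forall l' s1 s2, P l' s1 -> M s1 s2 -> P l' s2) ->
  (0 < size l)%N -> nth 0%N l 0 = B -> vars l s -> Inv s ->
  (forall l' s1, size l' = m -> all (fun k => k < B)%N l' ->
     vars (l ++ l') s1 -> Inv s1 -> M s s1 ->
     runs body s1 n (fun s2 =>
       [/\ vars (l ++ l') s2, Inv s2, M s1 s2 & P (l ++ l') s2])) ->
  runs (nest (size l) m body) s (nest_time n m) (fun s' =>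
    [/\ vars l s', Inv s', M s s' &
        forall l', size l' = m -> all (fun k => k < B)%N l' -> P (l ++ l') s']).
Proof.
move=> PM; elim: m l s => [|m IH] l s l0 lB vs Is hbody.
  apply: runs_weaken (hbody [::] s _ _ _ _ _) _ _; rewrite ?cats0 //.
  by move=> s' [v' I' M' P']; split=> // l' /size0nil -> _; rewrite cats0.
pose J x s' := [/\ vars (rcons l x) s', Inv s', M s s' &
  forall y l', (y < x)%N -> size l' = m -> all (fun k => k < B)%N l' -> P (l ++ y :: l') s'].
apply: (@runs_weaken _ _ (2 + B * (nest_time n m + 2)) _ (J B)) => //; last first.
  move=> s' [v' I' M' P']; split=> //; first by apply: (@vars_cat l [:: B]); rewrite cats1.
  by case=> [//|y l'] [sl'] /andP[yB lB']; apply: P'.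
apply: runs_for.
- move=> x s' [v' _ _ _]; split; have := v' 0%N; have := v' (size l);
    rewrite size_rcons !nth_rcons ltnn eqxx l0.
    by move=> _ h; rewrite /= h ?lB.
  by move=> ->.
- split; [|exact: Inv_sset|exact: M_sset|by []].
  by apply: vars_rcons; [exact: vars_sset|rewrite imem_sset eqxx].
move=> x s' xB [v' I' M' P'].
have szl : size (rcons l x) = (size l).+1 by rewrite size_rcons.
have szl0 : (0 < size (rcons l x))%N by rewrite szl.
have lB' : nth 0%N (rcons l x) 0 = B by rewrite nth_rcons l0.
rewrite -szl; apply: runs_weaken (IH (rcons l x) s' szl0 lB' v' I' _) _ _ => //.
  move=> l' s1 sl' all' v1 I1 M1; rewrite !cat_rcons in v1 *.
  by apply: hbody => //=; rewrite ?sl' ?xB //; apply: M_trans M1.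
move=> s2 [v2 I2 M2 P2]; split.
  by have := v2 (size l); rewrite szl nth_rcons ltnn eqxx => ->.
split.
- apply: vars_rcons; last by rewrite imem_sset eqxx.
  by apply: vars_sset => //; apply: (@vars_cat l [:: x]); rewrite cats1.
- exact: Inv_sset.
- by apply: M_trans (M_sset _ _ _); apply: M_trans M2.
move=> y l'; rewrite ltnS leq_eqVlt => /orP[/eqP -> sl' al'|yx sl' al'];
    apply: (PM _ _ _ _ (M_sset _ _ _)).
  by rewrite -cat_rcons; apply: P2.
by apply: (PM _ _ _ _ M2); apply: P'.
Qed.

End Nest.
End Logic.

(** * Text of the program *)

Definition address (e1 e2 e3 e4 : iexp) : iexp :=
  IAdd (IAdd (IAdd (IGet 15 e1) (IGet 14 e2)) (IGet 13 e3)) e4.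

Definition flag_exp (e : iexp) : bexp := ILe (IConst 1) (IGet 10 e).

Definition sum_cost : cexp :=
  CAdd (CAdd (CGet 1 (var 12)) (CGet 1 (var 13))) (CGet 1 (var 14)).

Definition component (k : nat) : iexp := IGet 11 (IAdd (var k) (IGet 16 (var 15))).

(** The target may coincide with a source: this is harmless because component
    [j] is overwritten only after its last use. *)
Definition relax : cmd :=
  If (BAnd (flag_exp (var 12)) (BAnd (flag_exp (var 13)) (BAnd (flag_exp (var 14))
       (BNot (BAnd (flag_exp (var 11)) (CLe (CGet 1 (var 11)) sum_cost))))))
    (Seq (CSet 1 (var 11) sum_cost)
      (Seq (ISet 10 (var 11) (IConst 1))
        (for_ 15 (var 0)
          (ISet 11 (IAdd (var 11) (IGet 16 (var 15)))
             (IAdd (IAdd (component 12) (component 13)) (component 14))))))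
    Skip.

Definition try_rule (g : bexp) (d e1 e2 e3 : iexp) : cmd :=
  If g (Seq (setv 11 d) (Seq (setv 12 e1) (Seq (setv 13 e2) (Seq (setv 14 e3) relax))))
    Skip.

Fixpoint conj (bs : seq bexp) : bexp :=
  if bs is b :: bs' then BAnd b (conj bs') else ILe (IConst 0) (IConst 0).

Definition zexp : iexp := IConst 0.
Definition copies_exp (e : iexp) : iexp := address zexp zexp (var 9) e.
Definition last_slot : bexp := BAnd (ILe (var 3) (succ (var 5))) (ILe (succ (var 5)) (var 3)).
Definition resource_exp (a : nat) : iexp := IGet a (var 9).

Definition copy_guard : bexp := ilt (succ (var 10)) (var 0).
Definition empty_guard : bexp := ilt zexp (var 2).
Definition concat_guard (bs : seq bexp) : bexp :=
  conj [:: ilt zexp (var 2), ILe (var 2) (var 5), ilt (IAdd (var 7) (var 8)) (var 0) & bs].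
Definition none_guard : bexp :=
  concat_guard [:: last_slot; ILe (var 8) (IGet 1 (var 5)); ILe (var 8) (var 4)].
Definition short_guard : bexp :=
  concat_guard [:: last_slot; ILe (var 8) (IGet 1 (var 5)); ilt (var 9) (IGet 0 (IConst 1));
    ILe (resource_exp 5) zexp; ILe (resource_exp 2) (var 5); ILe (var 5) (resource_exp 2);
    ILe (var 8) (IAdd (var 4) (resource_exp 4))].
(** The last test reads the stored total capacity of [f] copies in place of a product. It is
    meaningful only if that entry is flagged, which [relax] checks before writing. *)
Definition long_guard : bexp :=
  concat_guard [:: ILe (var 5) (var 3); ilt (var 9) (IGet 0 (IConst 1));
    ILe (IConst 1) (resource_exp 5); ILe (resource_exp 2) (var 5);
    ILe (var 3) (succ (resource_exp 3));
    ILe (var 6) (IGet 11 (IAdd (copies_exp (var 10)) (IGet 16 (IGet 0 (IConst 1)))))].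

Definition left_exp : iexp := address (var 2) (var 5) (var 4) (var 7).
Definition target_exp : iexp := address (var 2) (var 3) (var 4) (IAdd (var 7) (var 8)).

Definition body : cmd :=
  Seq (try_rule copy_guard (copies_exp (succ (var 10))) (copies_exp (var 10))
         (copies_exp (IConst 1)) zexp)
 (Seq (try_rule empty_guard (address (var 2) (var 2) (var 4) zexp) zexp zexp zexp)
 (Seq (try_rule none_guard target_exp left_exp zexp zexp)
 (Seq (try_rule short_guard target_exp left_exp (copies_exp (IConst 1)) zexp)
      (try_rule long_guard target_exp left_exp (copies_exp (var 10))
         (address (var 5) (var 3) (var 6) (var 8)))))).

Definition unit_exp : iexp := address zexp zexp (var 1) (IConst 1).

Definition init_unit : cmd :=
  If (ilt (var 1) (IGet 0 (IConst 1)))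
    (Seq (ISet 10 unit_exp (IConst 1))
    (Seq (CSet 1 unit_exp (CGet 0 (var 1)))
    (Seq (ISet 11 (IAdd unit_exp (IGet 16 (var 1))) (IConst 1))
         (ISet 11 (IAdd unit_exp (IGet 16 (IGet 0 (IConst 1)))) (IGet 4 (var 1))))))
    Skip.

Definition init : cmd := Seq (ISet 10 zexp (IConst 1)) (nest 1 1 init_unit).

(** Depth [B + horizon + nres + 1] suffices by [valid_derivable], and [B] exceeds [horizon + nres]
    by at least 2; hence twice [B] rounds. *)
Definition rounds : cmd := for_ 1 (IAdd (var 0) (var 0)) (nest 2 9 body).

Definition output : cmd :=
  Seq (setv 1 zexp)
 (Seq (If (ILe (IConst 1) (IGet 0 (IConst 2))) (setv 1 (IGet 0 (IConst 2))) Skip)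
      (If (BAnd (ilt (var 1) (var 0))
             (BNot (BAnd (ILe (IGet 0 zexp) zexp) (ilt (IGet 0 (IConst 2)) zexp))))
         (Seq (setv 2 (address (IConst 1) (succ (IGet 0 zexp)) zexp (var 1)))
            (If (flag_exp (var 2))
               (Seq (ISet 6 zexp (IConst 1))
                  (for_ 3 (var 0)
                     (ISet 7 (var 3) (IGet 11 (IAdd (var 2) (IGet 16 (var 3)))))))
               Skip))
         Skip)).

Definition count_bound : cmd :=
  Seq (setv 0 (IAdd (IAdd (IGet 0 zexp) (IGet 0 (IConst 1))) (IConst 2)))
    (for_ 1 (IGet 0 zexp) (setv 0 (IAdd (var 0) (IGet 1 (succ (var 1)))))).

(** The increment [B ^ k] of table [k] is the last entry, at index [B], of the table before it; this
    is why the tables extend to [B] inclusive. *)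
Definition stride (k : nat) : iexp := if k is k'.+1 then IGet (12 + k') (var 0) else IConst 1.

Definition power_table (k : nat) : cmd :=
  for_ 1 (var 0) (ISet (12 + k) (succ (var 1)) (IAdd (IGet (12 + k) (var 1)) (stride k))).

Definition preamble : cmd :=
  Seq count_bound (Seq (power_table 0) (Seq (power_table 1) (Seq (power_table 2)
    (Seq (power_table 3) (power_table 4))))).

Definition program : cmd := Seq preamble (Seq init (Seq rounds output)).

(** * Layout and invariant of the table *)

Section Table.
Variables (R : realDomainType) (I : lspc R) (B : nat).
Notation n := (nres I).
Implicit Types (s : state R) (p : point) (S : {ffun 'I_n -> nat}).

Definition in_range p : bool :=
  let: (a, b, h, q) := p in [&& a < B, b < B, h < B & q < B]%N.

Definition code p : nat :=
  let: (a, b, h, q) := p in (a * B ^ 3 + b * B ^ 2 + h * B ^ 1 + q)%N.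

Definition cell (j : nat) p : nat := (code p + j * B ^ 4)%N.

Lemma digit_inj u v x y :
  (x < B)%N -> (y < B)%N -> (u * B + x = v * B + y)%N -> u = v /\ x = y.
Proof.
move=> xB yB e; have B0 : (0 < B)%N by lia.
have := congr1 (divn^~ B) e; rewrite !divnMDl // !divn_small // !addn0 => uv.
by split=> //; move: e; rewrite uv => /addnI.
Qed.

(** A cell number is a base [B] numeral with digits [a, b, h, q] after a leading part [j] of any
    size, so vectors of different points never overlap. *)
Lemma cell_inj j j' p p' :
  in_range p -> in_range p' -> cell j p = cell j' p' -> p = p' /\ j = j'.
Proof.
have horner u a b h q : cell u (a, b, h, q) = ((((u * B + a) * B + b) * B + h) * B + q)%N.
  by rewrite /cell /= !expnS expn0; lia.
case: p p' => [[[a b] h] q] [[[a' b'] h'] q'] /and4P[? ? ? ?] /and4P[? ? ? ?].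
rewrite !horner => /digit_inj [//|//|] /digit_inj [//|//|] /digit_inj [//|//|] /digit_inj.
by move=> [//|//|] -> -> -> -> ->.
Qed.

Lemma code_inj p p' : in_range p -> in_range p' -> code p = code p' -> p = p'.
Proof.
move=> hp hp' e; have [] // := @cell_inj 0 0 p p' hp hp' _.
by rewrite /cell e.
Qed.

Hypothesis n_ltB : (n < B)%N.

(** Component [nres I] of a stored vector is its total capacity, which for the
    entry of [f] copies of [i] avoids multiplying [capacity i] by [f]. *)
Definition entry S (j : nat) : int := if insub j is Some i then (S i)%:Z else total_cap S.

Definition zero : {ffun 'I_n -> nat} := [ffun=> 0%N].

Lemma entry_zero j : entry zero j = 0.
Proof.
rewrite /entry; case: insubP => [i _ _|_]; rewrite ?ffunE //.
by rewrite /total_cap big1 // => i _; rewrite ffunE mulr0.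
Qed.

Lemma entry_madd3 S1 S2 S3 j :
  entry (madd3 S1 S2 S3) j = entry S1 j + entry S2 j + entry S3 j.
Proof.
rewrite /entry; case: insubP => [i _ _|_]; last exact: total_cap_madd3.
by rewrite ffunE !PoszD.
Qed.

Lemma entry_ord S (i : 'I_n) : entry S i = (S i)%:Z.
Proof. by rewrite /entry valK. Qed.

Lemma entry_cap S : entry S n = total_cap S.
Proof. by rewrite /entry insubF // ltnn. Qed.

Definition flagged s p : bool := 1 <= imem s 10 (code p)%:Z.
Definition cost_at s p : R := cmem s 1 (code p)%:Z.

Definition stored s p S : Prop :=
  cost_at s p = multiset_cost I S /\
  forall j, (j <= n)%N -> imem s 11 (cell j p)%:Z = entry S j.

(** Flagged entries hold genuine solutions, which is soundness. Unflagged ones still hold zeros, so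
    that [init] may write the nonzero components only. *)
Record Inv s : Prop := MkInv {
  Inv_input : forall a z, (a < 6)%N -> imem s a z = imem (input I) a z;
  Inv_cost : forall z, cmem s 0 z = cmem (input I) 0 z;
  Inv_output : imem s 6 0 = 0;
  Inv_tab : forall k x, (k < 5)%N -> (x <= B)%N ->
    imem s (12 + k) x%:Z = (x * B ^ k)%N%:Z;
  Inv_entry : forall p, in_range p -> exists S, stored s p S /\
    if flagged s p then valid p S else S = zero
}.

(** The preorder to which [runs_nest] is applied: flags stay set and costs never rise. *)
Definition improves s s' : Prop := forall p, in_range p -> flagged s p ->
  flagged s' p /\ cost_at s' p <= cost_at s p.

Lemma improves_refl s : improves s s. Proof. by []. Qed.

Lemma improves_trans s1 s2 s3 : improves s1 s2 -> improves s2 s3 -> improves s1 s3.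
Proof.
move=> h1 h2 p hp f1; have [f2 c2] := h1 p hp f1; have [f3 c3] := h2 p hp f2.
by split=> //; apply: le_trans c2.
Qed.

Definition same_core s s' : Prop :=
  (forall a z, (a < 19)%N -> imem s' a z = imem s a z) /\
  forall a z, cmem s' a z = cmem s a z.

Lemma Inv_core s s' : same_core s s' -> Inv s -> Inv s'.
Proof.
move=> [hi hc] [h1 h2 h3 h4 h5]; split.
- by move=> a z a6; rewrite hi ?h1 //; lia.
- by move=> z; rewrite hc.
- by rewrite hi.
- by move=> k x k5 xB; rewrite hi ?h4 //; lia.
move=> p /h5 [S [[c v] f]]; exists S; split; last by rewrite /flagged hi.
by split=> [|j jn]; [rewrite /cost_at hc|rewrite hi ?v].
Qed.

Lemma improves_core s s' : same_core s s' -> improves s s'.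
Proof. by move=> [hi hc] p hp f; rewrite /flagged /cost_at hi // hc. Qed.

Lemma imem_sset_lt s k v a z : (a < 19)%N -> imem (sset s k v) a z = imem s a z.
Proof. by move=> a19; rewrite imem_iset (ltn_eqF a19). Qed.

Lemma same_core_sset s k v : same_core s (sset s k v).
Proof. by split=> // a z; exact: imem_sset_lt. Qed.

Lemma Inv_sset s k v : Inv s -> Inv (sset s k v).
Proof. exact: Inv_core (same_core_sset _ _ _). Qed.

Lemma improves_sset s k v : improves s (sset s k v).
Proof. exact: improves_core (same_core_sset _ _ _). Qed.

Lemma entry_write s s' d S : Inv s -> in_range d -> valid d S ->
  (flagged s d -> multiset_cost I S <= cost_at s d) ->
  (forall a z, (a < 19)%N -> a != 10%N -> a != 11%N -> imem s' a z = imem s a z) ->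
  (forall z, cmem s' 0 z = cmem s 0 z) ->
  (forall p, in_range p -> p != d -> [/\ imem s' 10 (code p)%:Z = imem s 10 (code p)%:Z,
     cost_at s' p = cost_at s p &
     forall j, (j <= n)%N -> imem s' 11 (cell j p)%:Z = imem s 11 (cell j p)%:Z]) ->
  flagged s' d -> stored s' d S ->
  Inv s' /\ improves s s'.
Proof.
move=> [h1 h2 h3 h4 h5] dr vS imp hi hc hp fd st; split; last first.
  move=> p pr; have [->|pd] := eqVneq p d.
    by case: st => [-> _] /imp.
  by rewrite /flagged; have [-> -> _] := hp p pr pd.
split.
- by move=> a z a6; rewrite hi ?h1 //; lia.
- by move=> z; rewrite hc.
- by rewrite hi.
- by move=> k x k5 xB; rewrite hi ?h4 //; lia.
move=> p pr; have [->|pd] := eqVneq p d; first by exists S; rewrite fd.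
have [S' [[c v] f]] := h5 p pr; have [e1 e2 e3] := hp p pr pd.
exists S'; split; last by rewrite /flagged e1.
by split=> [|j jn]; rewrite ?e2 ?e3 ?v.
Qed.

Definition got s p c : Prop := flagged s p /\ cost_at s p <= c.

Lemma got_improves s s' p c : in_range p -> got s p c -> improves s s' -> got s' p c.
Proof.
by move=> pr [f c0] h; have [f' c'] := h p pr f; split=> //; apply: le_trans c0.
Qed.

(** Soundness is assumed only when [s2] is flagged, since the guard of [rule_long] draws its meaning
    from that entry. *)
Lemma runs_relax s (d s1 s2 s3 : point) :
  Inv s -> all in_range [:: d; s1; s2; s3] -> imem s 19 0 = B%:Z ->
  imem s 19 11 = (code d)%:Z -> imem s 19 12 = (code s1)%:Z ->
  imem s 19 13 = (code s2)%:Z -> imem s 19 14 = (code s3)%:Z ->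
  (flagged s s2 -> forall S1 S2 S3, valid s1 S1 -> valid s2 S2 -> valid s3 S3 ->
     valid d (madd3 S1 S2 S3)) ->
  runs relax s (3 * B + 5) (fun s' =>
    [/\ forall k, (k < 11)%N -> imem s' 19 k%:Z = imem s 19 k%:Z, Inv s', improves s s'
      & flagged s s1 -> flagged s s2 -> flagged s s3 ->
        got s' d (cost_at s s1 + cost_at s s2 + cost_at s s3)]).
Proof.
move=> Is /and5P[dr r1 r2 r3 _] vB vd v1 v2 v3 comb.
have -> : (3 * B + 5 = (1 + (1 + (2 + B * (1 + 2)))).+1)%N by lia.
apply: runs_if => /=; rewrite vd v1 v2 v3 -!/(flagged _ _) -!/(cost_at _ _); last first.
  move=> no; apply: runs_weaken (_ : runs Skip s 1 (eq s)) _ _; [exact: runs_skip|by []|].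
  move=> _ <-; split=> // f1 f2 f3; move: no; rewrite f1 f2 f3 /= negbK => /andP[fd cd].
  by split.
move=> /and4P[f1 f2 f3 better].
have [S1 [[c1 e1]]] := Inv_entry Is r1; rewrite f1 => vS1.
have [S2 [[c2 e2]]] := Inv_entry Is r2; rewrite f2 => vS2.
have [S3 [[c3 e3]]] := Inv_entry Is r3; rewrite f3 => vS3.
have vS := comb f2 _ _ _ vS1 vS2 vS3.
apply: runs_seq; apply: runs_cset => /=; rewrite vd v1 v2 v3 -!/(cost_at _ _).
set s' := cset _ _ _ _; apply: runs_seq; apply: runs_iset; rewrite [ieval _ _]/= vd.
set s'' := iset _ _ _ _.
have core2 a z : a != 10%N -> imem s'' a z = imem s a z by rewrite imem_iset => /negPf ->.
pose J x t := [/\ imem t 19 15 = x%:Z,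
  forall k, (k < 15)%N -> imem t 19 k%:Z = imem s 19 k%:Z,
  forall a z, (a < 19)%N -> a != 11%N -> imem t a z = imem s'' a z,
  cmem t = cmem s'' &
  (forall j, (j < x)%N -> imem t 11 (cell j d)%:Z =
    imem s 11 (cell j s1)%:Z + imem s 11 (cell j s2)%:Z + imem s 11 (cell j s3)%:Z) /\
  (forall z : nat, (forall j, (j < x)%N -> z <> cell j d) -> imem t 11 z%:Z = imem s 11 z%:Z)].
apply: runs_weaken (@runs_for _ _ _ B _ 1 _ J _ _ _) _ _ => //.
- by move=> x t [k15 kk _ _ _]; split=> //=; rewrite kk.
- split=> //.
  + by move=> k k_lt; rewrite imem_sset core2 // (ltn_eqF k_lt).
  + by move=> a z a19 a11; rewrite imem_sset_lt.
- move=> x t xB [k15 kk ka kc [k1 k2]]; apply: runs_iset.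
  have T4 : imem t 16 x%:Z = (x * B ^ 4)%N%:Z.
    by rewrite ka // core2 // (Inv_tab (k := 4) Is) // ltnW.
  have addr k p : (k < 15)%N -> imem s 19 k%:Z = (code p)%:Z ->
      ieval t (IAdd (var k) (IGet 16 (var 15))) = (cell x p)%:Z.
    by move=> k_15 vk; rewrite /= kk // vk k15 T4 /cell PoszD.
  have comp k p : (k < 15)%N -> imem s 19 k%:Z = (code p)%:Z -> in_range p ->
      ieval t (component k) = imem s 11 (cell x p)%:Z.
    move=> k_15 vk pr; rewrite /component; have := addr k p k_15 vk => /= ->.
    by apply: k2 => j jx /(cell_inj pr dr) [_ e]; rewrite -e ltnn in jx.
  have -> : ieval t (IAdd (IAdd (component 12) (component 13)) (component 14)) =
      imem s 11 (cell x s1)%:Z + imem s 11 (cell x s2)%:Z + imem s 11 (cell x s3)%:Z.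
    by rewrite -(comp 12%N s1) // -(comp 13%N s2) // -(comp 14%N s3).
  rewrite (addr 11%N d) //; split=> //; split.
  + by rewrite imem_sset.
  + by move=> k k_lt; rewrite imem_sset (ltn_eqF k_lt); exact: kk.
  + by move=> a z a19 a11; rewrite imem_sset_lt // imem_iset (negPf a11) ka.
  + by [].
  split=> [j|z hz]; rewrite imem_sset_lt //.
    rewrite ltnS leq_eqVlt imem_iset eqxx /= => /orP[/eqP ->|jx]; first by rewrite eqxx.
    case: eqP => [[e]|_]; last exact: k1.
    by have [_ ej] := cell_inj dr dr e; rewrite ej ltnn in jx.
  rewrite imem_iset eqxx /=; case: eqP => [[e]|_]; first by case: (hz x).
  by apply: k2 => j jx; apply: hz; exact: ltnW.
move=> t [_ kk ka kc [k1 k2]].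
have st : stored t d (madd3 S1 S2 S3).
  split=> [|j jn]; first by rewrite /cost_at kc /= /upd !eqxx cost_madd3 c1 c2 c3.
  by rewrite k1 ?(leq_ltn_trans jn n_ltB) // entry_madd3 e1 ?e2 ?e3.
have fd : flagged t d by rewrite /flagged ka // imem_iset !eqxx.
have [It Mt] : Inv t /\ improves s t.
  apply: (entry_write Is dr vS _ _ _ _ fd st).
  - by move=> fd'; move: better; rewrite fd' /= -ltNge cost_madd3 c1 c2 c3 => /ltW.
  - by move=> a z a19 a10 a11; rewrite ka // core2.
  - by move=> z; rewrite kc /= /upd.
  move=> p pr pd; have cpd : code p != code d by apply: contra_neq pd; exact: code_inj.
  split.
  - by rewrite ka // imem_iset eqxx /= eqz_nat (negPf cpd).
  - by rewrite /cost_at kc /= /upd eqxx /= eqz_nat (negPf cpd).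
  move=> j jn; apply: k2 => j' _ /(cell_inj pr dr) [e]; by rewrite e eqxx in pd.
split=> //; first by move=> k k11; apply: kk; exact: ltn_trans k11 _.
by move=> _ _ _; split=> //; case: st => -> _; rewrite cost_madd3 c1 c2 c3.
Qed.

(** Sources are measured in [s0], the state at the start of the round, and the target in [s];
    in-place improvements during the round can only help. *)
Definition relaxed s0 (d s1 s2 s3 : point) s : Prop :=
  flagged s0 s1 -> flagged s0 s2 -> flagged s0 s3 ->
  got s d (cost_at s0 s1 + cost_at s0 s2 + cost_at s0 s3).

(** Scalars 11 to 14 are set one after another, so the address expressions must be correct in every
    state with the same counters and the invariant. *)
Lemma runs_try l s0 s g ed e1 e2 e3 (d s1 s2 s3 : point) :
  size l = 11%N -> nth 0%N l 0 = B -> vars l s -> Inv s -> improves s0 s ->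
  (beval s g -> all in_range [:: d; s1; s2; s3]) ->
  (beval s g -> forall t, vars l t -> Inv t ->
     [/\ ieval t ed = (code d)%:Z, ieval t e1 = (code s1)%:Z,
         ieval t e2 = (code s2)%:Z & ieval t e3 = (code s3)%:Z]) ->
  (beval s g -> flagged s s2 -> forall S1 S2 S3,
     valid s1 S1 -> valid s2 S2 -> valid s3 S3 -> valid d (madd3 S1 S2 S3)) ->
  runs (try_rule g ed e1 e2 e3) s (3 * B + 10) (fun s' =>
    [/\ vars l s', Inv s', improves s s' & beval s g -> relaxed s0 d s1 s2 s3 s']).
Proof.
move=> sl lB vs Is imp rng addr comb.
have -> : (3 * B + 10 = (1 + (1 + (1 + (1 + (3 * B + 5))))).+1)%N by lia.
apply: runs_if => [gs|ng]; last first.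
  apply: runs_weaken (_ : runs Skip s 1 (eq s)) _ _; [exact: runs_skip|by []|].
  by move=> _ <-; split=> // gs; rewrite gs in ng.
have vset t k v : (10 < k)%N -> vars l t -> vars l (sset t k v).
  by move=> k10; apply: vars_sset; rewrite sl.
do 4!(apply: runs_seq; apply: runs_setv).
set t1 := sset s _ _; set t2 := sset t1 _ _; set t3 := sset t2 _ _; set t4 := sset t3 _ _.
have v1 : vars l t1 by exact: vset. have v2 : vars l t2 by exact: vset.
have v3 : vars l t3 by exact: vset. have v4 : vars l t4 by exact: vset.
have I1 : Inv t1 by exact: Inv_sset. have I2 : Inv t2 by exact: Inv_sset.
have I3 : Inv t3 by exact: Inv_sset. have I4 : Inv t4 by exact: Inv_sset.
have [a1 _ _ _] := addr gs _ vs Is; have [_ a2 _ _] := addr gs _ v1 I1.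
have [_ _ a3 _] := addr gs _ v2 I2; have [_ _ _ a4] := addr gs _ v3 I3.
have core a z : (a < 19)%N -> imem t4 a z = imem s a z.
  by move=> a19; rewrite !imem_sset_lt.
have /and5P[rd r1 r2 r3 _] := rng gs.
apply: runs_weaken (@runs_relax t4 d s1 s2 s3 I4 (rng gs) _ _ _ _ _ _) (leqnn _) _.
- by rewrite (v4 0%N) ?sl // lB.
- by rewrite !imem_sset /= a1.
- by rewrite !imem_sset /= a2.
- by rewrite !imem_sset /= a3.
- by rewrite !imem_sset /= a4.
- by rewrite /flagged core //; exact: comb.
move=> s' [kk I' M' got']; split=> //.
  by apply: vars_eq v4 => k; rewrite sl => kl; exact: kk.
move=> _ f1 f2 f3; have [g1 c1] := imp _ r1 f1; have [g2 c2] := imp _ r2 f2.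
have [g3 c3] := imp _ r3 f3.
have [] := got'; rewrite /flagged ?core // => fd cd; split=> //.
by apply: le_trans cd _; rewrite /cost_at -!/(cost_at _ _) !lerD.
Qed.

Lemma beval_conj s bs : beval s (conj bs) = all (beval s) bs.
Proof. by elim: bs => //= b bs ->. Qed.

Lemma read_table (A : Type) (x0 : A) m (f : 'I_m -> A) (i : 'I_m) : table x0 f (i : nat)%:Z = f i.
Proof. by rewrite /table valK. Qed.

Section Reads.
Variables (s : state R) (Is : Inv s).

Lemma read_horizon : imem s 0 0 = (horizon I)%:Z. Proof. by rewrite (Inv_input Is). Qed.
Lemma read_nres : imem s 0 1 = n%:Z. Proof. by rewrite (Inv_input Is). Qed.
Lemma read_target : imem s 0 2 = target I. Proof. by rewrite (Inv_input Is). Qed.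
Lemma read_demand t : imem s 1 t%:Z = (dem I t)%:Z.
Proof. by rewrite (Inv_input Is) //= /dem; case: ifP. Qed.
Lemma read_start (i : 'I_n) : imem s 2 (i : nat)%:Z = (start i)%:Z.
Proof. by rewrite (Inv_input Is) //; exact: read_table. Qed.
Lemma read_finish (i : 'I_n) : imem s 3 (i : nat)%:Z = (finish i)%:Z.
Proof. by rewrite (Inv_input Is) //; exact: read_table. Qed.
Lemma read_capacity (i : 'I_n) : imem s 4 (i : nat)%:Z = capacity i.
Proof. by rewrite (Inv_input Is) //; exact: read_table. Qed.
Lemma read_long (i : 'I_n) : imem s 5 (i : nat)%:Z = (is_long i : nat)%:Z.
Proof. by rewrite (Inv_input Is) //; exact: read_table. Qed.
Lemma read_cost (i : 'I_n) : cmem s 0 (i : nat)%:Z = cost i.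
Proof. by rewrite (Inv_cost Is); exact: read_table. Qed.

Lemma ieval_address e1 e2 e3 e4 a b h q :
  in_range (a, b, h, q) -> ieval s e1 = a%:Z -> ieval s e2 = b%:Z ->
  ieval s e3 = h%:Z -> ieval s e4 = q%:Z ->
  ieval s (address e1 e2 e3 e4) = (code (a, b, h, q))%:Z.
Proof.
move=> /and4P[aB bB hB qB] /= -> -> -> ->.
by rewrite (Inv_tab (k := 3) Is) ?(Inv_tab (k := 2) Is) ?(Inv_tab (k := 1) Is) ?PoszD // ltnW.
Qed.

End Reads.

(** * One pass through the loop body *)

Section Body.
Variables (r a b h x g q1 q2 i f : nat).
Let args := [:: a; b; h; x; g; q1; q2; i; f].
Let l := [:: B, r & args].
Hypothesis args_lt : all (fun k => k < B)%N args.

Let range : [/\ a < B, b < B, h < B, x < B & [/\ g < B, q1 < B, q2 < B, i < B & f < B]]%N.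
Proof. by have /and5P[-> -> -> -> /and5P[-> -> -> -> /andP[-> _]]] := args_lt. Qed.

Lemma rule_in_range (d s1 s2 s3 : point) :
  rule I B a b h x g q1 q2 i f d s1 s2 s3 -> all in_range [:: d; s1; s2; s3].
Proof.
have [aB bB hB xB [gB q1B q2B iB fB]] := range.
by case=> {d s1 s2 s3} [fB'|a0|ax bx qB q2d q2h|j ij|j ij *]; try have := ltn_ord j;
  rewrite /= ?aB ?bB ?hB ?xB ?gB ?q1B ?q2B ?iB ?fB; lia.
Qed.

Section Guards.
Variables (s : state R).
Hypotheses (vs : vars l s) (Is : Inv s).

Let val k : (k < 11)%N -> imem s 19 k%:Z = (nth 0%N l k)%:Z.
Proof. exact: vs. Qed.

Lemma copy_guardE : beval s copy_guard = (f.+1 < B)%N.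
Proof. by rewrite /= !val //=; lia. Qed.

Lemma empty_guardE : beval s empty_guard = (0 < a)%N.
Proof. by rewrite /= !val //=; lia. Qed.

Lemma none_guardE : beval s none_guard =
  [&& (0 < a)%N, (a <= x)%N, (q1 + q2 < B)%N, b == x.+1, (q2 <= dem I x)%N & (q2 <= h)%N].
Proof. by rewrite /none_guard beval_conj /= !val //= read_demand //; lia. Qed.

Lemma short_guardP : beval s short_guard <-> exists j : 'I_n,
  [/\ i = j, ~~ is_long j, start j = x, (0 < a <= x)%N &
   [/\ b = x.+1, (q1 + q2 < B)%N, (q2 <= dem I x)%N & q2%:Z <= h%:Z + capacity j]].
Proof.
rewrite /short_guard beval_conj /= !val //= read_demand // read_nres //.
split=> [hyp|[j [ij lj sj ax [bx qB qd qc]]]].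
  have ltin : (i < n)%N by lia.
  exists (Ordinal ltin); have ij : i = Ordinal ltin by []; move: hyp.
  move: (read_long Is (Ordinal ltin)) (read_start Is (Ordinal ltin)) (read_capacity Is (Ordinal
      ltin)).
  move=> /= -> -> -> hyp.
  by split=> //; [case: is_long hyp => //=; lia|lia|lia|split; lia].
move: (read_long Is j) (read_start Is j) (read_capacity Is j); rewrite -ij => -> -> ->.
rewrite (negPf lj) /=.
by have := ltn_ord j; lia.
Qed.

(** A flagged entry of this kind holds exactly [f] copies of [j], so its total capacity is the
    product that the machine cannot compute directly. *)
Lemma copies_cap (j : 'I_n) : i = j -> flagged s (0, 0, i, f)%N ->
  imem s 11 (cell n (0, 0, i, f)%N)%:Z = capacity j * f%:Z.
Proof.
move=> ij fl; have [_ _ _ _ [_ _ _ iB fB]] := range.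
have [|S [[_ vS]]] := Inv_entry Is (p := (0, 0, i, f)%N); first by rewrite /= iB fB; lia.
rewrite fl /= => hS; rewrite vS // entry_cap /total_cap (bigD1 j) //= big1 ?addr0.
  by rewrite hS ij eqxx mul1n.
by move=> k /eqP kj; rewrite hS ij; case: eqP => [/val_inj //|]; rewrite mulr0.
Qed.

Lemma ieval_copies e k : ieval s e = k%:Z -> (k < B)%N ->
  ieval s (copies_exp e) = (code (0, 0, i, k)%N)%:Z.
Proof.
move=> ek kB; have [_ _ _ _ [_ _ _ iB _]] := range.
by apply: ieval_address; rewrite //= ?val // iB kB; lia.
Qed.

Lemma long_guardP : flagged s (0, 0, i, f)%N -> beval s long_guard <-> exists j : 'I_n,
  [/\ i = j, is_long j, (0 < a <= x)%N, (x <= b)%N &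
   [/\ (start j <= x)%N, (b <= (finish j).+1)%N, g%:Z <= capacity j * f%:Z & (q1 + q2 < B)%N]].
Proof.
move=> fl; have [_ _ _ _ [_ _ _ iB fB]] := range.
have ec : ieval s (copies_exp (var 10)) = (code (0, 0, i, f)%N)%:Z.
  by apply: ieval_copies; rewrite //= val.
rewrite /long_guard beval_conj; move: ec; rewrite /= !val //= read_nres // => ->.
rewrite (Inv_tab (k := 4) Is) ?(ltnW n_ltB) // -PoszD -/(cell n (0, 0, i, f)%N).
split=> [hyp|[j [ij lj ax xb [sx bf gc qB]]]].
  have ltin : (i < n)%N by lia.
  exists (Ordinal ltin); have ij : i = Ordinal ltin by [].
  move: hyp; rewrite (copies_cap ij fl).
  move: (read_long Is (Ordinal ltin)) (read_start Is (Ordinal ltin)) (read_finish Is (Ordinal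
      ltin)).
  move=> /= -> -> -> hyp.
  by split=> //; [case: is_long hyp => //=; lia|lia|lia|split; lia].
rewrite (copies_cap ij fl).
move: (read_long Is j) (read_start Is j) (read_finish Is j); rewrite -ij => -> -> ->.
rewrite lj /=.
by have := ltn_ord j; lia.
Qed.

(** Obtained from the common tests alone: the target address must be in range even while
    [long_guard] cannot be interpreted for lack of a flag. *)
Let concat_guard_lt bs : beval s (concat_guard bs) -> (q1 + q2 < B)%N.
Proof. by rewrite beval_conj /= !val //=; lia. Qed.

Lemma none_guard_lt : beval s none_guard -> (q1 + q2 < B)%N.
Proof. by rewrite /none_guard => /concat_guard_lt. Qed.

Lemma short_guard_lt : beval s short_guard -> (q1 + q2 < B)%N.
Proof. by rewrite /short_guard => /concat_guard_lt. Qed.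

Lemma long_guard_lt : beval s long_guard -> (q1 + q2 < B)%N.
Proof. by rewrite /long_guard => /concat_guard_lt. Qed.

Lemma ieval_left : ieval s left_exp = (code (a, x, h, q1))%:Z.
Proof.
by have [aB bB hB xB [gB q1B _ _ _]] := range; apply: ieval_address; rewrite //= ?val //; lia.
Qed.

Lemma ieval_target : (q1 + q2 < B)%N -> ieval s target_exp = (code (a, b, h, q1 + q2)%N)%:Z.
Proof.
by have [aB bB hB xB _] := range => qB; apply: ieval_address; rewrite //= ?val //; lia.
Qed.

Lemma ieval_right : ieval s (address (var 5) (var 3) (var 6) (var 8)) = (code (x, b, g, q2))%:Z.
Proof.
by have [aB bB hB xB [gB q1B q2B _ _]] := range; apply: ieval_address; rewrite //= ?val //; lia.
Qed.

Lemma ieval_empty : ieval s (address (var 2) (var 2) (var 4) zexp) = (code (a, a, h, 0%N))%:Z.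
Proof.
by have [aB bB hB xB _] := range; apply: ieval_address; rewrite //= ?val //; lia.
Qed.

Lemma ieval_copies_f : ieval s (copies_exp (var 10)) = (code (0, 0, i, f)%N)%:Z.
Proof. by have [_ _ _ _ [_ _ _ iB fB]] := range; apply: ieval_copies; rewrite //= val. Qed.

End Guards.

Lemma runs_body s0 s : vars l s -> Inv s -> improves s0 s ->
  runs body s (5 * (3 * B + 10)) (fun s' => [/\ vars l s', Inv s', improves s s' &
    forall d s1 s2 s3 : point, in_range d ->
      rule I B a b h x g q1 q2 i f d s1 s2 s3 -> relaxed s0 d s1 s2 s3 s']).
Proof.
move=> vs Is imp; have [aB bB hB xB [gB q1B q2B iB fB]] := range.
have B0 : (0 < B)%N by lia.
have -> : (5 * (3 * B + 10) =
  (3 * B + 10) + ((3 * B + 10) + ((3 * B + 10) + ((3 * B + 10) + (3 * B + 10)))))%N by lia.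
apply: runs_seq; apply: runs_weaken (@runs_try l s0 s copy_guard _ _ _ _ (0, 0, i, f.+1)%N (0,
    0, i, f)%N (0, 0, i, 1)%N origin
  erefl erefl vs Is imp _ _ _) (leqnn _) _.
- by rewrite (copy_guardE vs) => ?; rewrite /= iB fB B0; lia.
- rewrite (copy_guardE vs) => f1B t vt It; split=> //.
  + by apply: (ieval_copies vt It) => //=; rewrite (vt 10%N) //=; lia.
  + exact: ieval_copies_f.
  + by apply: (ieval_copies vt It) => //; lia.
- by rewrite (copy_guardE vs) => f1B _ S1 S2 S3; apply: (@valid_rule _ _ B 0 0 0 0 0 0 0 i f);
    exact: rule_copy.
move=> t1 [v1 I1 m1 done1]; have imp1 := improves_trans imp m1.
apply: runs_seq; apply: runs_weaken (@runs_try l s0 t1 empty_guard _ _ _ _ (a, a, h, 0)%N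
    origin origin origin
  erefl erefl v1 I1 imp1 _ _ _) (leqnn _) _.
- by move=> _; rewrite /= aB hB B0.
- by move=> _ t vt It; split=> //; exact: ieval_empty.
- rewrite (empty_guardE v1) => a0 _ S1 S2 S3.
  by apply: (@valid_rule _ _ B a 0 h 0 0 0 0 0 0); exact: rule_empty.
move=> t2 [v2 I2 m2 done2]; have imp2 := improves_trans imp1 m2.
apply: runs_seq; apply: runs_weaken (@runs_try l s0 t2 none_guard _ _ _ _ (a, b, h, q1 + q2)%N
    (a, x, h, q1) origin origin
  erefl erefl v2 I2 imp2 _ _ _) (leqnn _) _.
- by move=> gd; have qB := none_guard_lt v2 gd; rewrite /= aB bB hB xB q1B qB B0.
- move=> gd t vt It; have qB := none_guard_lt v2 gd; split=> //;
    [exact: ieval_target|exact: ieval_left].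
- rewrite (none_guardE v2 I2) => /and5P[a0 ax qB /eqP bx /andP[q2d q2h]] _ S1 S2 S3.
  by apply: (@valid_rule _ _ B a b h x 0 q1 q2 0 0); apply: rule_none => //; lia.
move=> t3 [v3 I3 m3 done3]; have imp3 := improves_trans imp2 m3.
apply: runs_seq; apply: runs_weaken (@runs_try l s0 t3 short_guard _ _ _ _ (a, b, h, q1 + q2)%N
    (a, x, h, q1) (0, 0, i, 1)%N origin
  erefl erefl v3 I3 imp3 _ _ _) (leqnn _) _.
- move=> gd; have /(short_guardP v3 I3)[j _] := gd; have := ltn_ord j.
  by have := short_guard_lt v3 gd => qB jn; rewrite /= aB bB hB xB q1B qB iB; lia.
- move=> gd t vt It; have /(short_guardP v3 I3)[j _] := gd; have jn := ltn_ord j.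
  have qB := short_guard_lt v3 gd.
  by split=> //; [exact: ieval_target|exact: ieval_left|apply: (ieval_copies vt It) => //; lia].
- move=> /(short_guardP v3 I3)[j [ij lj sj ax [bx qB q2d q2h]]] _ S1 S2 S3.
  by apply: (@valid_rule _ _ B a b h x 0 q1 q2 i 0);
      exact: (@rule_short _ _ _ _ _ _ _ _ _ _ _ _ j).
move=> t4 [v4 I4 m4 done4]; have imp4 := improves_trans imp3 m4.
apply: runs_weaken (@runs_try l s0 t4 long_guard _ _ _ _ (a, b, h, q1 + q2)%N (a, x, h, q1) (0,
    0, i, f)%N (x, b, g, q2)
  erefl erefl v4 I4 imp4 _ _ _) (leqnn _) _.
- by move=> gd; have qB := long_guard_lt v4 gd; rewrite /= aB bB hB xB q1B qB iB fB gB q2B; lia.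
- move=> gd t vt It; have qB := long_guard_lt v4 gd; split=> //;
    [exact: ieval_target|exact: ieval_left|exact: ieval_copies_f|exact: ieval_right].
- move=> gd fl; have [j [ij lj ax xb [sx bf gc qB]]] := proj1 (long_guardP v4 I4 fl) gd.
  move=> S1 S2 S3; apply: (@valid_rule _ _ B a b h x g q1 q2 i f).
  exact: (@rule_long _ _ _ _ _ _ _ _ _ _ _ _ j).
move=> t5 [v5 I5 m5 done5]; split=> //.
  by do 4!(apply: improves_trans; first eassumption).
have keep t (d s1 s2 s3 : point) : in_range d -> relaxed s0 d s1 s2 s3 t -> improves t t5 ->
    relaxed s0 d s1 s2 s3 t5.
  by move=> dr dn mt f1 f2 f3; apply: got_improves mt => //; apply: dn.
have m45 := m5; have m35 := improves_trans m4 m45; have m25 := improves_trans m3 m35.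
have m15 := improves_trans m2 m25.
move=> d s1 s2 s3 dr ru; have rr := rule_in_range ru; move: dr rr; case: ru => {d s1 s2 s3}.
- move=> f1B dr _; apply: keep m15 => //; apply: done1; by rewrite (copy_guardE vs).
- move=> a0 dr _; apply: keep m25 => //; apply: done2; by rewrite (empty_guardE v1).
- move=> /andP[a0 ax] bx qB q2d q2h dr _; apply: keep m35 => //; apply: done3.
  by rewrite (none_guardE v2 I2) a0 ax qB q2d q2h bx eqxx.
- move=> j ij lj sj ax bx qB q2d q2h dr _; apply: keep m45 => //; apply: done4.
  by apply/(short_guardP v3 I3); exists j.
move=> j ij lj ax xb sx bf gc qB dr /and5P[_ _ r2 _ _] f1 f2 f3.
(* The flag of the copies persists from [s0] to [t4], where the long guard is evaluated and can now
   be interpreted. *)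
have [f2' _] := imp4 _ r2 f2.
by apply: done5 => //; apply/(long_guardP v4 I4 f2'); exists j.
Qed.

End Body.

(** * Initialisation and rounds of relaxation *)

Definition covered s0 (l : seq nat) s : Prop :=
  forall d s1 s2 s3 : point, in_range d ->
    rule I B (nth 0 l 2) (nth 0 l 3) (nth 0 l 4) (nth 0 l 5) (nth 0 l 6)
      (nth 0 l 7) (nth 0 l 8) (nth 0 l 9) (nth 0 l 10) d s1 s2 s3 ->
    relaxed s0 d s1 s2 s3 s.

Definition complete r s : Prop :=
  forall p c, in_range p -> derivable I B r p c -> got s p c.

(** The last step of a derivation of depth [r + 1] is one of the relaxed rules, and its sources were
    already present, at no greater cost, when the round began. *)
Lemma runs_round r s : vars [:: B; r] s -> Inv s -> complete r s ->
  runs (nest 2 9 body) s (nest_time B (5 * (3 * B + 10)) 9) (fun s' =>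
    [/\ vars [:: B; r] s', Inv s' & complete r.+1 s']).
Proof.
move=> vs Is cs.
apply: runs_weaken (@runs_nest R B Inv improves improves_refl improves_trans Inv_sset
  improves_sset 9 body (5 * (3 * B + 10)) (covered s) [:: B; r] s _ isT erefl vs Is _)
  (leqnn _) _.
- move=> l s1 s2 cov m12 d p1 p2 p3 dr ru f1 f2 f3.
  by apply: got_improves m12 => //; apply: (cov d).
- case=> [//|a [//|b [//|h [//|x [//|g [//|q1 [//|q2 [//|i [//|f [|//]]]]]]]]]] s1 _ lB v1 I1 m1.
  exact: runs_body.
move=> s' [v' I' m' cov]; split=> // p c pr; move Er : r.+1 => r' der.
case: der Er pr => {r' p c} [r' _|r' j _|r' a b h x g q1 q2 i f d p1 p2 p3 c1 c2 c3 lB ru].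
- by move=> pr; apply: got_improves m' => //; apply: cs => //; exact: derivable_origin.
- by move=> pr; apply: got_improves m' => //; apply: cs => //; exact: derivable_unit.
move=> d1 d2 d3 [Er]; rewrite -{}Er in d1 d2 d3 => dr.
have /and5P[_ r1 r2 r3 _] := rule_in_range lB ru.
have [f1 k1] := cs _ _ r1 d1; have [f2 k2] := cs _ _ r2 d2; have [f3 k3] := cs _ _ r3 d3.
have [fd kd] := cov [:: a; b; h; x; g; q1; q2; i; f] erefl lB _ _ _ _ dr ru f1 f2 f3.
by split=> //; apply: le_trans kd _; rewrite !lerD.
Qed.
Definition single (i : 'I_n) : {ffun 'I_n -> nat} := [ffun k => (k == i) : nat].

Lemma cost_single i : multiset_cost I (single i) = cost i.
Proof.
rewrite /multiset_cost (bigD1 i) //= big1 ?ffunE ?eqxx ?addr0 // => k /negPf ki.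
by rewrite ffunE ki.
Qed.

Lemma total_cap_single i : total_cap (single i) = capacity i.
Proof.
rewrite /total_cap (bigD1 i) //= big1 ?ffunE ?eqxx ?addr0 ?mulr1 // => k /negPf ki.
by rewrite ffunE ki mulr0.
Qed.

Lemma valid_single (i : 'I_n) : valid (0, 0, i : nat, 1)%N (single i).
Proof. by move=> j /=; rewrite ffunE muln1. Qed.

Lemma cost_zero : multiset_cost I zero = 0.
Proof. by rewrite /multiset_cost big1 // => i _; rewrite ffunE. Qed.

Lemma runs_init_unit s i : vars [:: B; i] s -> (i < B)%N -> Inv s ->
  runs init_unit s 5 (fun s' => [/\ vars [:: B; i] s', Inv s', improves s s' &
    forall j : 'I_n, i = j -> got s' (0, 0, i, 1)%N (cost j)]).
Proof.
move=> vs iB Is; apply: (@runs_if _ _ _ _ _ 4); rewrite /= (vs 1%N) // (read_nres Is) /=;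
    last first.
  move=> ni; apply: runs_weaken (_ : runs Skip s 1 (eq s)) _ _; [exact: runs_skip|by []|].
  by move=> _ <-; split=> // j ij; have := ltn_ord j; rewrite -ij; lia.
move=> ltin; have {}ltin : (i < n)%N by lia.
pose j := Ordinal ltin; pose d : point := (0, 0, i, 1)%N.
have dr : in_range d by rewrite /= iB; lia.
have unitE t : vars [:: B; i] t -> Inv t -> ieval t unit_exp = (code d)%:Z.
  by move=> vt It; apply: (ieval_address It dr) => //; exact: (vt 1%N).
have [S [[cS eS] fS]] := Inv_entry Is dr.
(* Whether or not the entry is flagged, its other components are 0, so two writes complete the
   vector: component [i] and the total capacity. *)
have S0 k : k != j -> S k = 0%N.
  move=> kj; move: fS; case: ifP => _; last by move=> ->; rewrite ffunE.
  by move=> /= ->; case: eqP => // e; case/eqP: kj; apply: val_inj.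
have adr t : (forall z', imem t 19 z' = imem s 19 z') ->
    (forall a z, (a < 10)%N || (11 < a < 19)%N -> imem t a z = imem s a z) ->
    ieval t unit_exp = (code d)%:Z.
  move=> e19 ea; rewrite /unit_exp /= (ea 15%N) // (ea 14%N) // (ea 13%N) // e19 (vs 1%N) //=.
  by have := unitE s vs Is; rewrite /= (vs 1%N).
apply: (@runs_seq _ _ _ _ 1 3); apply: runs_iset; rewrite unitE //.
set s1 := iset _ _ _ _.
have a1 a z : (a < 10)%N || (11 < a < 19)%N -> imem s1 a z = imem s a z.
  by move=> h; rewrite imem_iset; case: eqP h => // ->.
apply: (@runs_seq _ _ _ _ 1 2); apply: runs_cset; rewrite adr //.
have -> : ceval s1 (CGet 0 (var 1)) = cost j.
  by rewrite [LHS]/(cmem s 0 (imem s 19 1%N)) (vs 1%N) //; exact: (read_cost Is j).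
set s2 := cset _ _ _ _.
apply: (@runs_seq _ _ _ _ 1 1); apply: runs_iset.
have -> : ieval s2 (IAdd unit_exp (IGet 16 (var 1))) = (cell i d)%:Z.
  rewrite [LHS]/(ieval s2 unit_exp + imem s2 16 (imem s 19 1%N)) adr // (vs 1%N) //.
  by rewrite imem_cset a1 // (Inv_tab (k := 4) Is) // ltnW.
set s3 := iset _ _ _ _.
have a3 a z : (a < 10)%N || (11 < a < 19)%N -> imem s3 a z = imem s a z.
  by move=> h; rewrite imem_iset; case: eqP h => [-> //|_ h]; rewrite imem_cset a1.
apply: runs_iset.
have -> : ieval s3 (IAdd unit_exp (IGet 16 (IGet 0 (IConst 1)))) = (cell n d)%:Z.
  rewrite [LHS]/(ieval s3 unit_exp + imem s3 16 (imem s3 0 1%N)) adr // !a3 // (read_nres Is).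
  by rewrite (Inv_tab (k := 4) Is) // ltnW.
have -> : ieval s3 (IGet 4 (var 1)) = capacity j.
  by apply: etrans (_ : imem s3 4 (imem s 19 1%N) = _) => //; rewrite a3 // (vs 1%N) //;
      exact: (read_capacity Is j).
set s4 := iset _ _ _ _.
have vS : valid d (single j) by exact: (valid_single j).
have st : stored s4 d (single j).
  split; first by rewrite /cost_at /= /upd !eqxx cost_single.
  move=> k kn; rewrite /s4 imem_iset_eq; case: eqP => [[e]|ne].
    by have [_ ->] := cell_inj dr dr e; rewrite entry_cap total_cap_single.
  have {}kn : (k < n)%N by move: kn; rewrite leq_eqVlt => /orP[/eqP kn|//]; case: ne; rewrite kn.
  rewrite /s3 imem_iset_eq; case: eqP => [[e]|ne'].
    by have [_ ->] := cell_inj dr dr e; rewrite (entry_ord _ j) ffunE eqxx.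
  have kj : Ordinal kn != j by apply: contra_not_neq ne' => -[->].
  rewrite /s2 imem_cset /s1 imem_iset_neq // eS ?(ltnW kn) //.
  by rewrite (entry_ord S (Ordinal kn)) (entry_ord _ (Ordinal kn)) S0 // ffunE (negPf kj).
have fd : flagged s4 d by rewrite /flagged /= /upd !eqxx.
have [I4 m4] : Inv s4 /\ improves s s4.
  apply: (entry_write Is dr vS _ _ _ _ fd st).
  - move=> fds; move: fS; rewrite fds cS /= => hS; suff -> : S = single j by [].
    by apply/ffunP => k; rewrite hS ffunE muln1.
  - by move=> a z a19 a10 a11;
      rewrite /s4 imem_iset_neq // /s3 imem_iset_neq // imem_cset imem_iset_neq.
  - by [].
  move=> p pr pd; have cpd : code p != code d by apply: contra_neq pd; exact: code_inj.
  split.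
  - by rewrite /s4 imem_iset_neq // /s3 imem_iset_neq // imem_cset imem_iset_eq eqz_nat (negPf
      cpd).
  - by rewrite /cost_at /= /upd eqxx /= eqz_nat (negPf cpd).
  move=> k kn; rewrite /s4 imem_iset_eq /s3 imem_iset_eq imem_cset imem_iset_neq //.
  by do 2!(case: eqP => [[/(cell_inj pr dr) [e _]]|_]; first by rewrite e eqxx in pd).
split=> //.
by move=> j' ij; split=> //; case: st => -> _; rewrite cost_single (_ : j = j') //;
    apply: val_inj.
Qed.

Lemma runs_init s : vars [:: B] s -> Inv s ->
  runs init s (1 + nest_time B 5 1) (fun s' => [/\ vars [:: B] s', Inv s' & complete 0 s']).
Proof.
move=> vs Is; have B0 : (0 < B)%N by lia.
have r0 : in_range origin by rewrite /= B0.
apply: runs_seq; apply: runs_iset; rewrite [ieval s zexp]/= [ieval s _]/=.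
set s1 := iset _ _ _ _; have v1 : vars [:: B] s1 by apply: vars_eq vs.
have [S [[cS eS] fS]] := Inv_entry Is r0.
have S0 : S = zero.
  by move: fS; case: ifP => // _ /valid_origin hS; apply/ffunP => i; rewrite hS ffunE.
have v0 : valid origin zero by move=> j /=; rewrite ffunE muln0.
have f1 : flagged s1 origin by [].
have st : stored s1 origin zero by rewrite -S0.
have [I1 m1] : Inv s1 /\ improves s s1.
  apply: (entry_write Is r0 v0 _ _ _ _ f1 st) => //.
  - by rewrite cS S0.
  - by move=> a z a19 /negPf a10 /negPf a11; rewrite imem_iset a10.
  move=> p pr pd; split=> //.
  rewrite imem_iset /=; case: eqP => // e; case/eqP: pd; apply: (code_inj pr r0).
  by case: e.
apply: runs_weaken (@runs_nest R B Inv improves improves_refl improves_trans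
  Inv_sset improves_sset 1 init_unit 5
  (fun l s' => forall j : 'I_n, nth 0%N l 1 = j -> got s' (0, 0, j : nat, 1)%N (cost j))
  [:: B] s1 _ isT erefl v1 I1 _) (leqnn _) _.
- move=> l s2 s3 gt m23 j lj; apply: got_improves m23; last exact: gt.
  by have := ltn_ord j; rewrite /= B0; lia.
- case=> [//|i [|//]] s2 _ /= /andP[iB _] v2 I2 m2.
  apply: runs_weaken (runs_init_unit v2 iB I2) (leqnn _) _ => s3 [v3 I3 m3 gt].
  by split=> // j ij; rewrite -ij; apply: gt.
move=> s' [v' I' m' gt]; split=> // p c pr; move Er : 0%N => r der.
case: der Er pr => {r p c} [r _ _|r j _ jr|//].
  by apply: got_improves m' => //; split=> //; case: st => -> _; rewrite cost_zero.
by apply: (gt [:: j : nat]) => //=; have := ltn_ord j; lia.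
Qed.

Lemma runs_rounds s : vars [:: B] s -> Inv s -> complete 0 s ->
  runs rounds s (2 + (B + B) * (nest_time B (5 * (3 * B + 10)) 9 + 2)) (fun s' =>
    [/\ vars [:: B] s', Inv s' & complete (B + B) s']).
Proof.
move=> vs Is cs.
have keep r t k v : complete r t -> complete r (sset t k v).
  by move=> ct p c pr der; apply: (got_improves pr (ct _ _ pr der)); exact: improves_sset.
pose J r t := [/\ vars [:: B; r] t, Inv t & complete r t].
apply: runs_weaken (@runs_for _ _ _ (B + B) _ _ s J _ _ _) (leqnn _) _.
- by move=> r t [vt _ _]; rewrite /= (vt 0%N) // (vt 1%N).
- split; [|exact: Inv_sset|exact: keep].
  by apply: (@vars_rcons _ [:: B]); [exact: vars_sset|rewrite imem_sset].
- move=> r t _ [vt It ct]; apply: runs_weaken (runs_round vt It ct) (leqnn _) _.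
  move=> t' [vt' It' ct']; split; first by rewrite (vt' 1%N).
  split; [|exact: Inv_sset|exact: keep].
  apply: (@vars_rcons _ [:: B]); [|by rewrite imem_sset].
  by apply: vars_sset => //; apply: (@vars_cat _ [:: B] [:: r]).
by move=> t [vt It ct]; split=> //; apply: (@vars_cat _ [:: B] [:: B + B]%N).
Qed.

(** * Reading off an optimum *)

Hypothesis B_def : B = (n + horizon I + dsum I + 2)%N.

Lemma need_ltB : (exists S, slra_solution I S) -> (need I < B)%N.
Proof. by case=> S /solution_target[]; rewrite /need; case: (target I) => k; lia. Qed.

Lemma dem_ltB t : (dem I t < B)%N.
Proof.
suff : (dem I t <= dsum I)%N by lia.
rewrite /dem; case: ifP => // tT; rewrite /dsum (bigD1_seq t) ?iota_uniq ?mem_index_iota //=.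
exact: leq_addr.
Qed.

Lemma complete_solution s S : complete (B + B) s -> slra_solution I S ->
  got s (whole I) (multiset_cost I S).
Proof.
move=> cs sol; have qB := need_ltB (ex_intro _ S sol).
have [S' [vS' pos leS]] := solution_valid sol.
have wr : in_range (whole I) by rewrite /=; lia.
have [||||||c [der cS]] := @valid_derivable R I B _ n_ltB dem_ltB
    (horizon I + n) 1 (horizon I).+1 0 (need I) S' _ _ _ _ _ pos vS'; try lia.
  by have := max_card (long_support S'); rewrite card_ord; lia.
have [fw cw] : got s (whole I) c.
  by apply: cs => //; apply: derivable_le der; lia.
by split=> //; apply: le_trans cw _; apply: le_trans leS.
Qed.

(** The invariant makes the entry at [whole] a solution, and completeness makes it no dearer than
    any other; an unset flag means that no solution exists. *)
Lemma runs_output s : vars [:: B] s -> Inv s -> complete (B + B) s ->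
  runs output s (3 * B + 9) (fun s' =>
    (exists S, slra_optimum I S /\ returns s' S) \/
    ((forall S, ~ slra_solution I S) /\ returns_none s')).
Proof.
move=> vs Is cs.
have B1 : (1 < B)%N by lia.
have -> : (3 * B + 9 = 1 + (2 + (1 + (1 + (2 + B * (1 + 2))).+1).+1))%N by lia.
apply: runs_seq; apply: runs_setv; set s1 := sset _ _ _.
pose J t := vars [:: B; need I] t /\ same_core s t.
apply: runs_seq; apply: (@runs_weaken _ _ _ 2 2 J) => //.
  have e1 : ieval s1 (IGet 0 (IConst 2)) = target I.
    by rewrite -[LHS]/(imem s1 0 2%N) /s1 imem_sset_lt // (read_target Is).
  apply: (@runs_if _ _ _ _ _ 1);
      rewrite -[beval _ _]/(1 <= ieval s1 (IGet 0 (IConst 2))) e1 => ht.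
    apply: runs_setv; rewrite e1; split.
      apply: (@vars_rcons _ [:: B]); first by do 2!apply: vars_sset => //.
      by rewrite imem_sset; move: ht; rewrite /need; case: (target I).
    by split=> [a z a19|//]; rewrite !imem_sset_lt.
  apply: runs_skip; split; last by split=> [a z a19|//]; rewrite !imem_sset_lt.
  apply: (@vars_rcons _ [:: B]); first by apply: vars_sset.
  by rewrite imem_sset /=; move: ht; rewrite /need; case: (target I) => // -[|k].
move=> s2 [v2 core2]; have I2 := Inv_core core2 Is.
have c2 : complete (B + B) s2.
  move=> p c pr der; apply: (got_improves pr (cs _ _ pr der)); exact: improves_core.
apply: (@runs_if _ _ _ _ _ (1 + (1 + (2 + B * (1 + 2))).+1));
    rewrite /= (v2 0%N) // (v2 1%N) // (read_horizon I2) (read_target I2) /= => cond; last first.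
  apply: runs_weaken (_ : runs Skip s2 1 (eq s2)) _ _; [exact: runs_skip|by []|].
  move=> _ <-; right; split; last by rewrite /returns_none (Inv_output I2).
  move=> S sol; have := need_ltB (ex_intro _ S sol); have := solution_target sol.
  by move: cond; lia.
have hT : (0 < horizon I)%N \/ 0 <= target I by lia.
have qB : (need I < B)%N by lia.
have wr : in_range (whole I) by rewrite /=; lia.
apply: runs_seq; apply: runs_setv; rewrite (ieval_address I2 wr) //=; first last.
- by rewrite (v2 1%N).
- by rewrite (read_horizon I2); lia.
set s3 := sset _ _ _.
have core3 : same_core s2 s3 by exact: same_core_sset.
have I3 := Inv_core core3 I2.
have c3 : complete (B + B) s3.
  move=> p c pr der; apply: (got_improves pr (c2 _ _ pr der)); exact: improves_core.
have v3 : vars [:: B; need I] s3 by apply: vars_sset.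
have w3 : imem s3 19 2%N = (code (whole I))%:Z by rewrite imem_sset.
apply: (@runs_if _ _ _ _ _ (1 + (2 + B * (1 + 2))));
    rewrite -[beval _ _]/(1 <= imem s3 10 (imem s3 19 2%N)) w3 -/(flagged s3 (whole I)) => fw;
    last first.
  apply: runs_weaken (_ : runs Skip s3 1 (eq s3)) _ _; [exact: runs_skip|by []|].
  move=> _ <-; right; split; last by rewrite /returns_none (Inv_output I3).
  by move=> S /(complete_solution c3)[fw']; rewrite fw' in fw.
have [S [[cS eS]]] := Inv_entry I3 wr; rewrite fw => vS.
apply: runs_seq; apply: runs_iset; rewrite [ieval s3 zexp]/= [ieval s3 _]/=.
set s4 := iset _ _ _ _.
have e4 a z : a != 6%N -> imem s4 a z = imem s3 a z by exact: imem_iset_neq.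
pose K x (t : state R) := [/\ imem t 19 3%N = x%:Z, imem t 19 0%N = B%:Z, imem t 19 2%N = (code
    (whole I))%:Z,
  forall a z, (a < 19)%N -> a != 7%N -> imem t a z = imem s4 a z &
  forall j, (j < x)%N -> (j <= n)%N -> imem t 7 j%:Z = entry S j].
apply: runs_weaken (@runs_for _ _ _ B _ 1 _ K _ _ _) (leqnn _) _.
- by move=> x t [k3 k0 _ _ _].
- by split=> //; [exact: (v3 0%N)|move=> a z a19 a7; rewrite imem_sset_lt].
- move=> x t xB [k3 k0 k2 ka kj]; apply: runs_iset.
  have -> : ieval t (IGet 11 (IAdd (var 2) (IGet 16 (var 3)))) = imem s3 11 (cell x (whole I))%:Z.
    rewrite -[LHS]/(imem t 11 (imem t 19 2%N + imem t 16 (imem t 19 3%N))) k2 k3 !ka //.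
    rewrite !e4 // (Inv_tab (k := 4) I3) //.
    exact: ltnW.
  rewrite -[ieval t (var 3)]/(imem t 19 3%N) k3; split; first by rewrite imem_iset_neq.
  split=> //.
  + by move=> a z a19 a7; rewrite imem_sset_lt // imem_iset_neq // ka.
  + move=> j; rewrite ltnS imem_sset_lt // imem_iset_eq => jx jn; case: eqP => [[e]|ne].
      by rewrite -e eS.
    by apply: kj => //; move: ne jx; lia.
move=> t [_ _ _ ka kj]; left; exists S; split; last first.
  split=> [|i]; first by rewrite ka // imem_iset_eq eqxx.
  by rewrite kj ?entry_ord //; have := ltn_ord i; lia.
split; first exact: valid_solution hT vS.
by move=> S' /(complete_solution c3)[_]; rewrite cS.
Qed.

(** * Computing the bound and the multiplication tables *)

(** Tables below [m] are filled; in the others, cell 0 is still 0, the starting value of the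
    recurrence. *)
Record prelim (m : nat) s : Prop := MkPrelim {
  prelim_vars : vars [:: B] s;
  prelim_imem : forall a z, (a < 12)%N -> imem s a z = imem (input I) a z;
  prelim_cmem : forall a z, cmem s a z = cmem (input I) a z;
  prelim_tab : forall k x, (k < m)%N -> (x <= B)%N -> imem s (12 + k) x%:Z = (x * B ^ k)%N%:Z;
  prelim_zero : forall k, (m <= k < 5)%N -> imem s (12 + k) 0 = 0
}.

Lemma prelim_Inv s : prelim 5 s -> Inv s.
Proof.
case=> vs hi hc ht _; split=> //.
- by move=> a z a6; apply: hi; exact: ltn_trans a6 _.
- by rewrite hi.
move=> p pr; exists zero; have -> : flagged s p = false.
  by rewrite -[LHS]/(1 <= imem s 10 (code p)%:Z) hi.
split=> //; split=> [|j _]; last by rewrite hi // entry_zero.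
by rewrite -[LHS]/(cmem s 1 (code p)%:Z) hc cost_zero.
Qed.

Lemma runs_power_table m s : (m < 5)%N -> prelim m s ->
  runs (power_table m) s (2 + B * (1 + 2)) (prelim m.+1).
Proof.
move=> m5 [vs hi hc ht hz].
pose J x (t : state R) := [/\ vars [:: B;
    x] t, (forall a z, (a < 12)%N -> imem t a z = imem (input I) a z) /\
  (forall a z, cmem t a z = cmem (input I) a z),
  forall k y, (k < m)%N -> (y <= B)%N -> imem t (12 + k) y%:Z = (y * B ^ k)%N%:Z,
  forall y, (y <= x)%N -> imem t (12 + m) y%:Z = (y * B ^ m)%N%:Z &
  forall k, (m < k < 5)%N -> imem t (12 + k) 0 = 0].
have m19 : 19%N != (12 + m)%N by lia.
apply: runs_weaken (@runs_for _ _ _ B _ 1 _ J _ _ _) (leqnn _) _.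
- by move=> x t [vt _ _ _ _]; rewrite /= (vt 0%N) // (vt 1%N).
- split.
  + by apply: (@vars_rcons _ [:: B]); [exact: vars_sset|rewrite imem_sset].
  + by split=> // a z a12; rewrite imem_sset_lt ?hi //; exact: ltn_trans a12 _.
  + by move=> k y km yB; rewrite imem_sset_lt ?ht //; lia.
  + by move=> y; rewrite leqn0 => /eqP ->; rewrite imem_sset_lt ?hz ?mul0n //; lia.
  by move=> k km; rewrite imem_sset_lt ?hz //; lia.
- move=> x t xB [vt [ti tc] tt tm tz]; apply: runs_iset.
  have -> : ieval t (IAdd (IGet (12 + m) (var 1)) (stride m)) = (x.+1 * B ^ m)%N%:Z.
    have -> : ieval t (IAdd (IGet (12 + m) (var 1)) (stride m)) =
        imem t (12 + m) (imem t 19 1%N) + ieval t (stride m) by [].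
    rewrite (vt 1%N) //= tm //; have -> : ieval t (stride m) = (B ^ m)%N%:Z.
      case: m tt {ht hz m5 m19 tm tz J} => [//|k] tt; rewrite /= (vt 0%N) //= tt // expnS //.
    by rewrite mulSn PoszD addrC.
  have -> : ieval t (succ (var 1)) = x.+1%:Z by rewrite /= (vt 1%N) //=; lia.
  set t' := iset _ _ _ _.
  have e19 z : imem t' 19 z = imem t 19 z by rewrite imem_iset_neq.
  split; first by rewrite e19 (vt 1%N).
  split.
  + apply: (@vars_rcons _ [:: B]); last by rewrite imem_sset.
    by apply: vars_sset => // -[|//] _; rewrite e19 (vt 0%N).
  + split=> // a z a12; rewrite imem_sset_lt ?imem_iset_neq ?ti //; lia.
  + move=> k y km yB; rewrite imem_sset_lt ?imem_iset_neq ?tt //; lia.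
  + move=> y; rewrite imem_sset_lt; last by lia.
    by rewrite imem_iset_eq leq_eqVlt eqz_nat; case: eqP => [-> //|_]; exact: tm.
  by move=> k km; rewrite imem_sset_lt ?imem_iset_neq ?tz //; lia.
move=> t [vt [ti tc] tt tm tz]; split=> //; first exact: (@vars_cat _ [:: B] [:: B]).
by move=> k x; rewrite ltnS leq_eqVlt => /orP[/eqP -> xB|]; [exact: tm|exact: tt].
Qed.

Lemma runs_count_bound : runs count_bound (input I) (3 + horizon I * (1 + 2)) (prelim 0).
Proof.
have -> : (3 + horizon I * (1 + 2) = 1 + (2 + horizon I * (1 + 2)))%N by lia.
apply: runs_seq; apply: runs_setv; set s := sset _ _ _.
pose J x (t : state R) := [/\ imem t 19 0%N = (n + horizon I + 2 + \sum_(1 <= u < x.+1) demand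
    I u)%N%:Z,
  imem t 19 1%N = x%:Z, (forall a z, (a < 19)%N -> imem t a z = imem (input I) a z) &
  (forall a z, cmem t a z = cmem (input I) a z)].
apply: runs_weaken (@runs_for _ _ _ (horizon I) _ 1 _ J _ _ _) (leqnn _) _.
- by move=> x t [t0 t1 ti tc]; rewrite /= ti.
- split=> //.
  + by rewrite big_geq // addn0 /= /upd /=; lia.
  by move=> a z a19; rewrite imem_sset_lt // /s imem_sset_lt.
- move=> x t xT [t0 t1 ti tc]; apply: runs_setv.
  have -> : ieval t (IAdd (var 0) (IGet 1 (succ (var 1)))) =
      (n + horizon I + 2 + \sum_(1 <= u < x.+2) demand I u)%N%:Z.
    have -> : ieval t (IAdd (var 0) (IGet 1 (succ (var 1)))) =
      imem t 19 0%N + imem t 1 (imem t 19 1%N + 1) by [].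
    rewrite t0 t1 ti // (_ : x%:Z + 1 = x.+1%:Z); last by lia.
    by rewrite /= xT [in RHS]big_nat_recr //= addnA -PoszD.
  split; first by rewrite imem_sset.
  split=> //.
  by move=> a z a19; rewrite !imem_sset_lt ?ti.
move=> t [t0 t1 ti tc]; split=> //.
- by case=> // _; rewrite t0 /= B_def /dsum; lia.
- by move=> a z a12; apply: ti; exact: ltn_trans a12 _.
by move=> k k5; rewrite ti //; move: k k5; do 5!case=> //.
Qed.

Lemma runs_program : runs program (input I)
  (3 + horizon I * (1 + 2) + 5 * (2 + B * (1 + 2)) + (1 + nest_time B 5 1) +
   (2 + (B + B) * (nest_time B (5 * (3 * B + 10)) 9 + 2)) + (3 * B + 9))
  (fun s' => (exists S, slra_optimum I S /\ returns s' S) \/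
    ((forall S, ~ slra_solution I S) /\ returns_none s')).
Proof.
set p := (2 + B * (1 + 2))%N.
rewrite (_ : (_ + _ + _)%N = (3 + horizon I * (1 + 2) + (p + (p + (p + (p + p)))) +
  ((1 + nest_time B 5 1) + ((2 + (B + B) * (nest_time B (5 * (3 * B + 10)) 9 + 2)) +
  (3 * B + 9))))%N); last by rewrite !addnA; congr (_ + _ + _ + _)%N; lia.
apply: runs_seq; apply: runs_seq; apply: runs_weaken runs_count_bound (leqnn _) _ => s0 P0.
do 4!(apply: runs_seq; apply: runs_weaken (runs_power_table _ _) (leqnn _) _; [|eassumption|];
    [by []|move=> ? ?]).
apply: runs_weaken (runs_power_table _ _) (leqnn _) _; [|eassumption|]; [by []|move=> s P5].
apply: runs_seq; apply: runs_weaken (runs_init (prelim_vars P5) (prelim_Inv P5)) (leqnn _) _.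
move=> t [vt It ct]; apply: runs_seq.
apply: runs_weaken (runs_rounds vt It ct) (leqnn _) _ => u [vu Iu cu].
exact: runs_output.
Qed.

End Table.

(** * Polynomial time bound *)

(** One level turns [t] into [2 + B * (t + 2)], at most [B * (t + 4)]: a factor [B], and 4 more in
    the coefficient. *)
Lemma nest_time_le B c k t m : (0 < B)%N -> (t <= c * B ^ k)%N ->
  (nest_time B t m <= (c + 4 * m) * B ^ (m + k))%N.
Proof.
move=> B0 tc; elim: m => [|m IH]; first by rewrite muln0 addn0.
rewrite [nest_time _ _ _]/(2 + B * (nest_time B t m + 2))%N addSn expnS mulnCA.
apply: (@leq_trans (B * (nest_time B t m + 4))); first by rewrite !mulnDr; lia.
rewrite leq_pmul2l //; have : (0 < B ^ (m + k))%N by rewrite expn_gt0 B0.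
move: (B ^ _)%N IH => X IH X0.
by have -> : ((c + 4 * m.+1) * X = (c + 4 * m) * X + 4 * X)%N; lia.
Qed.

(** The theorem asks for one constant as both coefficient and exponent. *)
Lemma poly_exponent C k N : (0 < N)%N -> (C * N ^ k <= (C + k) * N ^ (C + k))%N.
Proof. by move=> N0; rewrite leq_mul ?leq_addr // leq_pexp2l // leq_addl. Qed.

Lemma dsum_le (R : realDomainType) (I : lspc R) : (dsum I <= horizon I * max_demand I)%N.
Proof.
have -> : (horizon I * max_demand I)%N = (\sum_(1 <= t < (horizon I).+1) max_demand I)%N.
  by rewrite sum_nat_const_nat subn1.
rewrite /dsum big_nat [leqRHS]big_nat; apply: leq_sum => t tT.
by rewrite /max_demand (bigD1_seq t) ?iota_uniq ?mem_index_iota //= leq_maxl.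
Qed.

Lemma program_time : exists C k, forall n T D H B,
  B = (n + T + D + 2)%N -> (D <= T * H)%N ->
  (3 + T * (1 + 2) + 5 * (2 + B * (1 + 2)) + (1 + nest_time B 5 1) +
   (2 + (B + B) * (nest_time B (5 * (3 * B + 10)) 9 + 2)) + (3 * B + 9) <=
   C * (n + T + H).+1 ^ k)%N.
Proof.
(* The total is at most [300 * B ^ 11], and [B <= 2 * N ^ 2]. *)
exists (300 * 2 ^ 11)%N, 22%N; move=> n T D H B BE DH; have B0 : (0 < B)%N by lia.
set N := (n + T + H).+1; have BN : (B <= 2 * N ^ 2)%N by rewrite BE /N; nia.
have TB : (T <= B)%N by lia.
clear BE; clearbody N; set b := (B ^ 10)%N; have b0 : (0 < b)%N by rewrite expn_gt0 B0.
have h9 : (nest_time B (5 * (3 * B + 10)) 9 <= 101 * b)%N.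
  (* The body takes [15 * B + 50], at most [65 * B], steps; nine levels raise the coefficient to
     [65 + 4 * 9 = 101]. *)
  by apply: (@nest_time_le B 65 1 _ 9 B0); rewrite expn1; lia.
have -> : (nest_time B 5 1 = 2 + B * 7)%N by [].
apply: (@leq_trans (300 * (B * b))); last first.
  rewrite -expnS -mulnA leq_mul2l /=; apply: (@leq_trans ((2 * N ^ 2) ^ 11)%N).
    by rewrite leq_exp2r.
  by rewrite expnMn -expnM.
move: (nest_time _ _ _) h9 => t h9.
have Bb : (B <= B * b)%N by rewrite leq_pmulr.
have Bt : (B * t <= 101 * (B * b))%N by rewrite mulnCA leq_mul2l h9 orbT.
by rewrite mulnDl mulnDr; lia.
Qed.

Theorem theorem5 :
  exists (p : cmd) (c : nat), forall (R : realDomainType) (I : lspc R),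
    exists (n : nat) (st : state R),
      [/\ exec p (input I) n st,
          (n <= c * (nres I + horizon I + max_demand I).+1 ^ c)%N
        & (exists S : {ffun 'I_(nres I) -> nat},
             slra_optimum I S /\ returns st S)
          \/ ((forall S : {ffun 'I_(nres I) -> nat}, ~ slra_solution I S)
              /\ returns_none st)].
Proof.
have [C [k time_le]] := program_time.
exists program, (C + k)%N => R I.
have nB : (nres I < nres I + horizon I + dsum I + 2)%N by lia.
have [m [st [run time result]]] := runs_program nB erefl.
exists m, st; split; [exact: run| |exact: result].
apply: leq_trans time (leq_trans (time_le _ _ _ _ _ erefl (dsum_le I)) _).
exact: poly_exponent.
Qed.
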